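(* Let $\mathbb{T}$ be a time scale with $\sup\mathbb{T}=+\infty$ and $\bar\mu_\mathbb{T}:=\sup_{t\in\mathbb{T}}\mu_\mathbb{T}(t)<+\infty$, and let $A$ be a real $n\times n$ matrix such that the system $x^\Delta=Ax$ on $\mathbb{T}$ is positive. Then $x^\Delta=Ax$ is positively uniformly exponentially stable if and only if all coefficients of the characteristic polynomial $\chi_A(\lambda)=\det(\lambda I-A)$ are positive.
   Context: A time scale is a nonempty closed subset $\mathbb{T}\subset\mathbb{R}$. For $t\in\mathbb{T}$, $\sigma_\mathbb{T}(t)=\inf\{s\in\mathbb{T}:s>t\}$ and the graininess is $\mu_\mathbb{T}(t)=\sigma_\mathbb{T}(t)-t$. The delta derivative $f^\Delta(t)$ is the number such that for every $\varepsilon>0$ there is $\delta>0$ with $|f(\sigma_\mathbb{T}(t))-f(s)-f^\Delta(t)(\sigma_\mathbb{T}(t)-s)|\le\varepsilon|\sigma_\mathbb{T}(t)-s|$ for all $s\in\mathbb{T}$, $|s-t|<\delta$ (ordinary derivative on $\mathbb{R}$, forward difference quotient $(f(t+h)-f(t))/h$ on $h\mathbb{Z}$). For $t_0\in\mathbb{T}$ and $x_0\in\mathbb{R}^n$ the system $x^\Delta=Ax$ has a unique forward solution with $x(t_0)=x_0$. The system $x^\Delta=Ax$ is positive if for every $t_0\in\mathbb{T}$ and every $x_0\in\mathbb{R}^n_+$ (vectors with nonnegative entries) the solution with $x(t_0)=x_0$ stays in $\mathbb{R}^n_+$ for all $t\ge t_0$. It is positively uniformly exponentially stable if there exist $K\ge1$,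 $\alpha>0$ and an open neighborhood $V$ of $0$ in $\mathbb{R}^n$ such that for all $t_0\le t$ in $\mathbb{T}$ and all $x_0\in\mathbb{R}^n_+\cap V$ the solution with $x(t_0)=x_0$ satisfies $\|x(t)\|\le K e^{-\alpha(t-t_0)}\|x_0\|$. *)

(* Defs.v *)
(* classical reals. Vectors in R^n are functions nat -> R
   (only indices i < n matter); n x n matrices are nat -> nat -> R. *)
From Stdlib Require Import Reals Lra Lia Arith.
Open Scope R_scope.

Fixpoint vsum (m : nat) (f : nat -> R) : R :=
  match m with
  | O => 0
  | S m' => vsum m' f + f m'
  end.

Definition is_closed_set (T : R -> Prop) : Prop :=
  forall x, (forall eps, eps > 0 -> exists t, T t /\ Rabs (t - x) < eps) -> T x.

Definition is_time_scale (T : R -> Prop) : Prop :=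
  (exists t, T t) /\ is_closed_set T.

Definition is_inf (S : R -> Prop) (m : R) : Prop :=
  (forall s, S s -> m <= s) /\
  (forall m', (forall s, S s -> m' <= s) -> m' <= m).

Definition is_sigma (T : R -> Prop) (t sg : R) : Prop :=
  is_inf (fun s => T s /\ t < s) sg.

Definition sup_infinite (T : R -> Prop) : Prop :=
  forall r, exists t, T t /\ r < t.

Definition bounded_graininess (T : R -> Prop) : Prop :=
  exists M, forall t sg, T t -> is_sigma T t sg -> sg - t <= M.

(** Delta derivative of a scalar function f at t, equal to v, computed relative
    to the domain D (a subset of T, e.g. T itself or T ∩ [t0, +oo)); sigma is
    the forward jump operator of T. *)
Definition delta_deriv_on (D T : R -> Prop) (f : R -> R) (t v : R) : Prop :=
  forall sg, is_sigma T t sg ->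
  forall eps, eps > 0 ->
    exists delta, delta > 0 /\
      forall s, D s -> Rabs (s - t) < delta ->
        Rabs (f sg - f s - v * (sg - s)) <= eps * Rabs (sg - s).

Definition matvec (n : nat) (A : nat -> nat -> R) (x : nat -> R) (i : nat) : R :=
  vsum n (fun j => A i j * x j).

Definition is_forward_solution (T : R -> Prop) (n : nat) (A : nat -> nat -> R)
    (t0 : R) (x : R -> nat -> R) : Prop :=
  forall t, T t -> t0 <= t ->
  forall i, (i < n)%nat ->
    delta_deriv_on (fun s => T s /\ t0 <= s) T (fun s => x s i) t (matvec n A (x t) i).

Definition nonneg_vec (n : nat) (v : nat -> R) : Prop :=
  forall i, (i < n)%nat -> 0 <= v i.

Definition vec_eq (n : nat) (v w : nat -> R) : Prop :=
  forall i, (i < n)%nat -> v i = w i.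

(** a norm on R^n (all norms are equivalent; l1 norm chosen) *)
Definition vnorm (n : nat) (v : nat -> R) : R := vsum n (fun i => Rabs (v i)).

Definition open_nbhd0 (n : nat) (V : (nat -> R) -> Prop) : Prop :=
  V (fun _ => 0) /\
  forall v, V v -> exists r, r > 0 /\
    forall w, (forall i, (i < n)%nat -> Rabs (w i - v i) < r) -> V w.

Definition positive_system (T : R -> Prop) (n : nat) (A : nat -> nat -> R) : Prop :=
  forall t0 (x0 : nat -> R) (x : R -> nat -> R),
    T t0 -> nonneg_vec n x0 ->
    is_forward_solution T n A t0 x -> vec_eq n (x t0) x0 ->
    forall t, T t -> t0 <= t -> nonneg_vec n (x t).

Definition pos_unif_exp_stable (T : R -> Prop) (n : nat) (A : nat -> nat -> R) : Prop :=
  exists K alpha (V : (nat -> R) -> Prop),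
    K >= 1 /\ alpha > 0 /\ open_nbhd0 n V /\
    forall t0 t (x0 : nat -> R) (x : R -> nat -> R),
      T t0 -> T t -> t0 <= t ->
      nonneg_vec n x0 -> V x0 ->
      is_forward_solution T n A t0 x -> vec_eq n (x t0) x0 ->
      vnorm n (x t) <= K * exp (- alpha * (t - t0)) * vnorm n x0.

(** polynomials as coefficient sequences: p k = coefficient of lambda^k *)
Definition poly := nat -> R.
Definition pconst (c : R) : poly := fun k => if Nat.eqb k 0 then c else 0.
Definition pX : poly := fun k => if Nat.eqb k 1 then 1 else 0.
Definition padd (p q : poly) : poly := fun k => p k + q k.
Definition pmul (p q : poly) : poly := fun k => vsum (S k) (fun i => p i * q (k - i)%nat).

Definition minor (M : nat -> nat -> poly) (j : nat) : nat -> nat -> poly :=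
  fun i k => M (S i) (if Nat.ltb k j then k else S k).

Fixpoint pdet (m : nat) (M : nat -> nat -> poly) : poly :=
  match m with
  | O => pconst 1
  | S m' => fun k => vsum m (fun j => (-1) ^ j * pmul (M O j) (pdet m' (minor M j)) k)
  end.

Definition charpoly (n : nat) (A : nat -> nat -> R) : poly :=
  pdet n (fun i j => if Nat.eqb i j then padd pX (pconst (- A i i))
                     else pconst (- A i j)).

(* Main.v *)
Require Import Defs.
From Stdlib Require Import Reals Lra Lia Factorial.
From Coquelicot Require Import Coquelicot.
From mathcomp Require all_boot all_order all_algebra perm ring.
From mathcomp.real_closed Require polyrcf.
From mathcomp Require Rstruct.
Open Scope R_scope.
Set Bullet Behavior "Strict Subproofs".

(** Solutions are series [x(t) = sum_k h_k(t, t0) A^k x0] in the generalized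
    monomials [h_k] of the time scale; positivity, tested near a single time on
    the solutions started at basis vectors, forces [A] to be Metzler.

    Stability implies positive coefficients: for a solution [x] with positive
    initial value, its integral [y] satisfies [A y = x(t) - x0 < 0] at a late
    time [t], and [y > 0] because [A] is Metzler. This excludes nonnegative real
    eigenvalues, so [det (- A) > 0], and it passes to principal submatrices. As
    the derivative of [chi_A] is the sum of the characteristic polynomials of
    the maximal principal submatrices, all coefficients are positive.

    Conversely, positive coefficients give [chi_A > 0] on [0, +oo), which for
    Metzler [A] yields a row [w > 0] with [w A < 0]; then [w x] is a linear
    Lyapunov function. *)

(** * Finite sums *)

Lemma vsum_ext m f g :
  (forall i, (i < m)%nat -> f i = g i) -> vsum m f = vsum m g.
Proof. induction m; cbn; auto; intros H; rewrite IHm, H; auto. Qed.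

Lemma vsum_le m f g :
  (forall i, (i < m)%nat -> f i <= g i) -> vsum m f <= vsum m g.
Proof. induction m; cbn; intros H; [lra|]; apply Rplus_le_compat; auto. Qed.

Lemma vsum_nonneg m f : (forall i, (i < m)%nat -> 0 <= f i) -> 0 <= vsum m f.
Proof. induction m; cbn; intros H; [lra|]; apply Rplus_le_le_0_compat; auto. Qed.

Lemma vsum_scal m c f : vsum m (fun i => c * f i) = c * vsum m f.
Proof. induction m; cbn; [|rewrite IHm]; ring. Qed.

Lemma vsum_ge_term m f i :
  (i < m)%nat -> (forall j, (j < m)%nat -> 0 <= f j) -> f i <= vsum m f.
Proof.
  induction m; intros Hi Hf; [lia|]; cbn.
  destruct (Nat.eq_dec i m) as [->|N].
  - pose proof (vsum_nonneg m f ltac:(auto)); lra.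
  - specialize (IHm ltac:(lia) ltac:(auto)); specialize (Hf m ltac:(lia)); lra.
Qed.

Lemma Rabs_vsum m f : Rabs (vsum m f) <= vsum m (fun i => Rabs (f i)).
Proof.
  induction m; cbn; [rewrite Rabs_R0; lra|].
  eapply Rle_trans; [apply Rabs_triang|]; lra.
Qed.

Lemma vsum_plus m f g : vsum m (fun i => f i + g i) = vsum m f + vsum m g.
Proof. induction m; cbn; [|rewrite IHm]; ring. Qed.

Lemma vsum_exchange m p (f : nat -> nat -> R) :
  vsum m (fun i => vsum p (fun j => f i j)) = vsum p (fun j => vsum m (fun i => f i j)).
Proof.
  induction m as [|m IH]; cbn.
  - rewrite (vsum_ext p _ (fun j => 0 * 0)) by (intros; ring).
    rewrite vsum_scal; ring.
  - rewrite IH, <- vsum_plus; reflexivity.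
Qed.

(** * Time scales *)

Lemma sigma_ge (T : R -> Prop) t sg : is_sigma T t sg -> t <= sg.
Proof. intros [_ H]; apply H; intros s [_ Hs]; lra. Qed.

Lemma sigma_le (T : R -> Prop) t sg s :
  is_sigma T t sg -> T s -> t < s -> sg <= s.
Proof. intros [H _] Ts Hs; apply H; auto. Qed.

(** Otherwise [sg + eps] would be a lower bound of the points after [t]. The strict [t < s] matters
    at right-dense points, where [sg = t]. *)
Lemma sigma_approx (T : R -> Prop) t sg eps :
  is_sigma T t sg -> 0 < eps -> exists s, T s /\ t < s /\ sg <= s < sg + eps.
Proof.
  intros [H1 H2] He.
  destruct (Classical_Prop.classic
    (exists s, T s /\ t < s /\ sg <= s < sg + eps)) as [|N]; [assumption|].
  assert (sg + eps <= sg); [|lra].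
  apply H2; intros s [Ts Hs].
  destruct (Rle_lt_dec (sg + eps) s) as [|L]; [assumption|].
  exfalso; apply N; exists s; repeat split; auto.
Qed.

Lemma sigma_in (T : R -> Prop) t sg : is_closed_set T -> is_sigma T t sg -> T sg.
Proof.
  intros HT H; apply HT; intros eps He.
  destruct (sigma_approx T t sg eps H He) as (s & Ts & _ & Hs).
  exists s; split; auto; apply Rabs_def1; lra.
Qed.

Lemma sigma_exists (T : R -> Prop) t : sup_infinite T -> exists sg, is_sigma T t sg.
Proof.
  intros Hinf.
  (* The infimum is minus the supremum of the reflected set. *)
  destruct (completeness (fun u => T (- u) /\ t < - u)) as [m [Hm1 Hm2]].
  - exists (- t); intros u [_ Hu]; lra.
  - destruct (Hinf t) as [s [Ts Hs]]; exists (- s).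
    rewrite Ropp_involutive; auto.
  - exists (- m); split.
    + intros s Hs; assert (- s <= m); [|lra].
      apply Hm1; rewrite Ropp_involutive; auto.
    + intros m' Hm'; assert (m <= - m'); [|lra].
      apply Hm2; intros u Hu; specialize (Hm' _ Hu); lra.
Qed.

(** Suppose [P] fails at [t], and let [c] be the supremum of the points of [T] up to which [P] holds
    throughout. The last hypothesis on [P] brings [P] to [c], the two before it carry [P] beyond
    [c], a contradiction. *)
Lemma time_scale_induction (T : R -> Prop) (P : R -> Prop) t0 :
  is_closed_set T -> sup_infinite T ->
  P t0 ->
  (forall t sg, T t -> t0 <= t -> is_sigma T t sg -> t < sg -> P t -> P sg) ->
  (forall t, T t -> t0 <= t -> is_sigma T t t -> P t ->
     exists d, 0 < d /\ forall s, T s -> t < s < t + d -> P s) ->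
  (forall t, T t -> t0 < t ->
     (forall d, 0 < d -> exists s, T s /\ t0 <= s /\ t - d < s < t /\ P s) -> P t) ->
  T t0 -> forall t, T t -> t0 <= t -> P t.
Proof.
  intros HT Hinf H0 Hsc Hrd Hld T0 t Tt Ht.
  destruct (Classical_Prop.classic (P t)) as [|NP]; [assumption|exfalso].
  set (S := fun c => T c /\ t0 <= c <= t /\
                     forall s, T s -> t0 <= s <= c -> P s).
  destruct (completeness S) as [c [Hc1 Hc2]].
  { exists t; intros c Hc; apply Hc. }
  { exists t0; split; auto; split; [lra|].
    intros s Ts Hs; replace s with t0 by lra; auto. }
  assert (S0 : S t0).
  { split; auto; split; [lra|]. intros s Ts Hs; replace s with t0 by lra; auto. }
  assert (c0 : t0 <= c) by (apply Hc1; auto).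
  assert (ct : c <= t) by (apply Hc2; intros u Hu; apply Hu).
  assert (Happ : forall d, 0 < d -> exists s, S s /\ c - d < s <= c).
  { intros d Hd.
    destruct (Classical_Prop.classic (exists s, S s /\ c - d < s <= c)) as [|N];
      [assumption|].
    assert (c <= c - d); [|lra].
    apply Hc2; intros u Hu.
    destruct (Rle_lt_dec u (c - d)) as [|L]; [assumption|].
    exfalso; apply N; exists u; split; auto; split; auto. }
  assert (Tc : T c).
  { apply HT; intros eps He; destruct (Happ eps He) as (s & Hs & Hsc').
    exists s; split; [apply Hs|]; apply Rabs_def1; lra. }
  assert (Hbelow : forall s, T s -> t0 <= s < c -> P s).
  { intros s Ts Hs; destruct (Happ (c - s)) as (u & Hu & Huc); [lra|].
    apply Hu; auto; lra. }
  assert (Pc : P c).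
  { destruct (Classical_Prop.classic (S c)) as [Sc|NSc].
    { apply Sc; auto; lra. }
    apply Hld; auto.
    - destruct c0 as [|E]; [assumption|]. subst c; tauto.
    - intros d Hd; destruct (Happ d Hd) as (s & Hs & Hs').
      assert (s <> c) by (intros ->; tauto).
      exists s; destruct Hs as (Ts & Hs1 & Hs2).
      repeat split; auto; try lra. apply Hs2; auto; lra. }
  assert (Sc : S c).
  { split; auto; split; [lra|]; intros s Ts Hs.
    destruct (Req_dec s c) as [->|]; auto; apply Hbelow; auto; lra. }
  assert (ct' : c < t).
  { destruct ct as [|E]; [assumption|]. subst c; tauto. }
  destruct (sigma_exists T c Hinf) as [sg Hsg].
  (* Right-scattered or right-dense, a point of [T] beyond [c] falls into [S], against the choice of
     [c]. *)
  destruct (sigma_ge T c sg Hsg) as [Hlt|Heq].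
  - assert (sgt : sg <= t) by (eapply sigma_le; eauto).
    assert (sg <= c); [|lra].
    apply Hc1; split; [eapply sigma_in; eauto|split; [lra|]].
    intros s Ts Hs; destruct (Rle_lt_dec s c) as [L|L].
    + apply Sc; auto; lra.
    + assert (sg <= s) by (eapply sigma_le; eauto).
      replace s with sg by lra; apply (Hsc c); auto.
  - rewrite <- Heq in Hsg; clear Heq; destruct (Hrd c Tc c0 Hsg Pc) as (d & Hd & HP).
    destruct (sigma_approx T c c (Rmin d (t - c)) Hsg) as (u & Tu & Hu1 & Hu2).
    { apply Rmin_glb_lt; lra. }
    pose proof (Rmin_l d (t - c)); pose proof (Rmin_r d (t - c)).
    assert (u <= c); [|lra].
    apply Hc1; split; auto; split; [lra|].
    intros s Ts Hs; destruct (Rle_lt_dec s c) as [L|L].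
    + apply Sc; auto; lra.
    + apply HP; auto; lra.
Qed.

(** * Delta derivatives *)

Section DeltaDerivative.

Variables (T : R -> Prop) (t0 : R).
Let D := fun s => T s /\ t0 <= s.

(** The choice [s = t] is always admissible in the definition, so the fixed error [e] is bounded by
    arbitrarily small multiples of [sg - t]. *)
Lemma delta_deriv_jump f t v sg :
  D t -> is_sigma T t sg -> delta_deriv_on D T f t v ->
  f sg = f t + v * (sg - t).
Proof.
  intros Dt Hsg Hf.
  pose proof (sigma_ge _ _ _ Hsg) as Hge.
  destruct (Req_dec (f sg) (f t + v * (sg - t))) as [|N]; [assumption|exfalso].
  set (e := Rabs (f sg - f t - v * (sg - t))).
  assert (He : 0 < e) by (apply Rabs_pos_lt; lra).
  (* This tolerance turns the bound into [e <= e * q] with [q < 1]; the [+ 1] covers [sg = t]. *)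
  destruct (Hf sg Hsg (e / (2 * (sg - t + 1)))) as (d & Hd & Hb).
  { apply Rdiv_lt_0_compat; lra. }
  specialize (Hb t Dt).
  rewrite Rminus_diag, Rabs_R0 in Hb; specialize (Hb Hd); fold e in Hb.
  rewrite (Rabs_right (sg - t)) in Hb by lra.
  assert (e / (2 * (sg - t + 1)) * (sg - t) = e * ((sg - t) / (2 * (sg - t + 1))))
    as E by (field; lra).
  rewrite E in Hb.
  assert ((sg - t) / (2 * (sg - t + 1)) < 1).
  { apply Rlt_div_l; lra. }
  nra.
Qed.

(** By the jump formula [f s - f t] equals [v * (s - t)] minus the error at [s]; each is kept within
    [eps / 2]. For [s] within 1 of [t], [m] bounds [Rabs (sg - s)]. *)
Lemma delta_deriv_continuous f t v :
  sup_infinite T -> D t -> delta_deriv_on D T f t v ->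
  forall eps, 0 < eps -> exists d, 0 < d /\
    forall s, D s -> Rabs (s - t) < d -> Rabs (f s - f t) < eps.
Proof.
  intros Hinf Dt Hf eps He.
  destruct (sigma_exists T t Hinf) as [sg Hsg].
  pose proof (sigma_ge _ _ _ Hsg) as Hge.
  pose proof (delta_deriv_jump f t v sg Dt Hsg Hf) as HJ.
  set (m := sg - t + 1).
  assert (Hm : 0 < m) by (unfold m; lra).
  destruct (Hf sg Hsg (eps / (2 * m))) as (d & Hd & Hb).
  { apply Rdiv_lt_0_compat; lra. }
  pose proof (Rabs_pos v) as Hv.
  exists (Rmin (Rmin d 1) (eps / (2 * (Rabs v + 1)))); split.
  { repeat apply Rmin_glb_lt; try lra. apply Rdiv_lt_0_compat; lra. }
  intros s Ds Hs.
  assert (s1 : Rabs (s - t) < d /\ Rabs (s - t) < 1 /\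
               Rabs (s - t) < eps / (2 * (Rabs v + 1))).
  { pose proof (Rmin_l (Rmin d 1) (eps / (2 * (Rabs v + 1)))).
    pose proof (Rmin_r (Rmin d 1) (eps / (2 * (Rabs v + 1)))).
    pose proof (Rmin_l d 1). pose proof (Rmin_r d 1). lra. }
  destruct s1 as (s1 & s2 & s3).
  specialize (Hb s Ds s1).
  assert (Hm' : Rabs (sg - s) <= m).
  { apply Rabs_def2 in s2. apply Rabs_le. unfold m. lra. }
  assert (B1 : eps / (2 * m) * Rabs (sg - s) <= eps / 2).
  { replace (eps / 2) with (eps / (2 * m) * m) by (field; lra).
    apply Rmult_le_compat_l; auto. apply Rlt_le, Rdiv_lt_0_compat; lra. }
  assert (B2 : Rabs (v * (s - t)) < eps / 2).
  { rewrite Rabs_mult.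
    apply Rlt_div_r in s3; [|lra]. pose proof (Rabs_pos (s - t)). nra. }
  replace (f s - f t) with
    (- (f sg - f s - v * (sg - s)) + v * (s - t)) by (rewrite HJ; ring).
  eapply Rle_lt_trans; [apply Rabs_triang|]. rewrite Rabs_Ropp. lra.
Qed.

Lemma delta_deriv_zero t : delta_deriv_on D T (fun _ => 0) t 0.
Proof.
  intros sg Hsg eps He; exists 1; split; [lra|]; intros s Ds Hs.
  replace (0 - 0 - 0 * (sg - s)) with 0 by ring; rewrite Rabs_R0.
  pose proof (Rabs_pos (sg - s)); nra.
Qed.

Lemma delta_deriv_plus f g t v w :
  delta_deriv_on D T f t v -> delta_deriv_on D T g t w ->
  delta_deriv_on D T (fun s => f s + g s) t (v + w).
Proof.
  intros Hf Hg sg Hsg eps He.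
  destruct (Hf sg Hsg (eps / 2)) as (d1 & Hd1 & Hb1); [lra|].
  destruct (Hg sg Hsg (eps / 2)) as (d2 & Hd2 & Hb2); [lra|].
  exists (Rmin d1 d2); split; [apply Rmin_glb_lt; lra|].
  intros s Ds Hs.
  pose proof (Rmin_l d1 d2); pose proof (Rmin_r d1 d2).
  specialize (Hb1 s Ds ltac:(lra)); specialize (Hb2 s Ds ltac:(lra)).
  replace (f sg + g sg - (f s + g s) - (v + w) * (sg - s)) with
    ((f sg - f s - v * (sg - s)) + (g sg - g s - w * (sg - s))) by ring.
  eapply Rle_trans; [apply Rabs_triang|]; lra.
Qed.

Lemma delta_deriv_scal c f t v :
  delta_deriv_on D T f t v -> delta_deriv_on D T (fun s => c * f s) t (c * v).
Proof.
  intros Hf sg Hsg eps He.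
  pose proof (Rabs_pos c).
  destruct (Hf sg Hsg (eps / (Rabs c + 1))) as (d & Hd & Hb).
  { apply Rdiv_lt_0_compat; lra. }
  exists d; split; auto; intros s Ds Hs; specialize (Hb s Ds Hs).
  replace (c * f sg - c * f s - c * v * (sg - s)) with
    (c * (f sg - f s - v * (sg - s))) by ring.
  rewrite Rabs_mult.
  apply Rle_trans with (Rabs c * (eps / (Rabs c + 1) * Rabs (sg - s))).
  { apply Rmult_le_compat_l; auto. }
  replace (Rabs c * (eps / (Rabs c + 1) * Rabs (sg - s))) with
    ((Rabs c / (Rabs c + 1)) * (eps * Rabs (sg - s))) by (field; lra).
  assert (Rabs c / (Rabs c + 1) <= 1) by (apply Rle_div_l; lra).
  pose proof (Rabs_pos (sg - s)).
  assert (0 <= eps * Rabs (sg - s)) by nra. nra.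
Qed.

Lemma delta_deriv_vsum m (f : nat -> R -> R) (v : nat -> R) t :
  (forall i, (i < m)%nat -> delta_deriv_on D T (f i) t (v i)) ->
  delta_deriv_on D T (fun s => vsum m (fun i => f i s)) t (vsum m v).
Proof.
  induction m as [|m IH]; intros H; cbn.
  - apply delta_deriv_zero.
  - apply delta_deriv_plus; auto.
Qed.

(** Induction along [T] proves the bound with a slack [eps * (t - t0)], which absorbs the
    first-order error at right-dense points; then [eps] tends to 0. *)
Lemma delta_deriv_nonneg_nondecreasing f v :
  is_closed_set T -> sup_infinite T -> T t0 ->
  (forall t, T t -> t0 <= t -> delta_deriv_on D T f t (v t)) ->
  (forall t, T t -> t0 <= t -> 0 <= v t) ->
  forall t, T t -> t0 <= t -> f t0 <= f t.
Proof.
  intros HT Hinf T0 Hf Hv t Tt Ht.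
  assert (Key : forall eps, 0 < eps -> f t0 - eps * (t - t0) <= f t).
  { intros eps He; revert t Tt Ht.
    apply (time_scale_induction T (fun t => f t0 - eps * (t - t0) <= f t)); auto.
    - lra.
    - intros t sg Tt Ht Hsg Hlt IH.
      rewrite (delta_deriv_jump f t (v t) sg (conj Tt Ht) Hsg (Hf t Tt Ht)).
      specialize (Hv t Tt Ht); nra.
    - intros t Tt Ht Hsg IH.
      destruct (Hf t Tt Ht t Hsg eps He) as (d & Hd & Hb).
      exists d; split; auto; intros s Ts Hs.
      assert (Hb' : Rabs (f t - f s - v t * (t - s)) <= eps * Rabs (t - s)).
      { apply Hb; [split; [assumption|lra]|apply Rabs_def1; lra]. }
      rewrite (Rabs_left (t - s)) in Hb' by lra.
      apply Rabs_le_between in Hb'.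
      specialize (Hv t Tt Ht); nra.
    - intros t Tt Ht Happ.
      apply le_epsilon; intros e He'.
      destruct (delta_deriv_continuous f t (v t) Hinf (conj Tt (Rlt_le _ _ Ht))
        (Hf t Tt (Rlt_le _ _ Ht)) e He') as (d & Hd & Hb).
      destruct (Happ d Hd) as (s & Ts & Hs0 & Hs & IH).
      assert (Hb' : Rabs (f s - f t) < e).
      { apply Hb; [split; assumption|apply Rabs_def1; lra]. }
      apply Rabs_def2 in Hb'.
      assert (0 <= eps * (t - s)) by (apply Rmult_le_pos; lra); lra. }
  apply le_epsilon; intros e He.
  specialize (Key (e / (t - t0 + 1)) ltac:(apply Rdiv_lt_0_compat; lra)).
  assert (e / (t - t0 + 1) * (t - t0) <= e); [|lra].
  replace (e / (t - t0 + 1) * (t - t0)) with (e * ((t - t0) / (t - t0 + 1)))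
    by (field; lra).
  assert ((t - t0) / (t - t0 + 1) <= 1) by (apply Rle_div_l; lra).
  nra.
Qed.

(* The rate drops from [a] to [b < a]; the margin absorbs the first-order
   error at right-dense points. *)
Lemma delta_deriv_exp_decay f v a b :
  is_closed_set T -> sup_infinite T -> T t0 -> 0 < b < a ->
  (forall t, T t -> t0 <= t -> delta_deriv_on D T f t (v t)) ->
  (forall t, T t -> t0 <= t -> v t <= - a * f t) ->
  (forall t, T t -> t0 <= t -> 0 <= f t) ->
  forall t, T t -> t0 <= t -> f t <= exp (- b * (t - t0)) * f t0.
Proof.
  intros HT Hinf T0 Hab Hf Hv Hpos t Tt Ht.
  (* A [C] strictly above [f t0] is positive, so the margin [(a - b) * (E * C)] used below is
     nonzero even when [f t0 = 0]. *)
  assert (Key : forall C, f t0 < C -> f t <= exp (- b * (t - t0)) * C).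
  { intros C HC.
    assert (C0 : 0 < C) by (specialize (Hpos t0 T0 ltac:(lra)); lra).
    revert t Tt Ht.
    assert (Hexp : forall s t, exp (- b * (s - t0)) =
                    exp (- b * (t - t0)) * exp (- b * (s - t))).
    { intros s t; rewrite <- exp_plus; f_equal; ring. }
    apply (time_scale_induction T (fun t => f t <= exp (- b * (t - t0)) * C)); auto.
    - rewrite Rminus_diag, Rmult_0_r, exp_0; lra.
    - intros t sg Tt Ht Hsg Hlt IH.
      rewrite (delta_deriv_jump f t (v t) sg (conj Tt Ht) Hsg (Hf t Tt Ht)).
      rewrite (Hexp sg t).
      specialize (Hv t Tt Ht); specialize (Hpos t Tt Ht).
      set (h := sg - t) in *.
      assert (hp : 0 < h) by (unfold h; lra).
      pose proof (exp_ineq1_le (- b * h)) as Hx.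
      pose proof (exp_pos (- b * h)) as Hx'.
      set (E := exp (- b * (t - t0))) in *.
      assert (EC : 0 < E * C) by (apply Rmult_lt_0_compat; auto; apply exp_pos).
      assert (f t + v t * h <= f t * (1 - a * h)) by nra.
      (* The jump may be longer than [/ a]; then the new value is at most 0. Otherwise
         [1 - a * h <= 1 - b * h <= exp (- b * h)]. *)
      destruct (Rle_lt_dec 0 (1 - a * h)).
      + assert (f t * (1 - a * h) <= E * C * (1 - a * h)) by nra.
        assert (1 - a * h <= exp (- b * h)) by nra.
        assert (E * C * (1 - a * h) <= E * C * exp (- b * h))
          by (apply Rmult_le_compat_l; lra).
        lra.
      + assert (f t * (1 - a * h) <= 0) by nra.
        assert (0 < E * C * exp (- b * h)) by nra. lra.
    - intros t Tt Ht Hsg IH.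
      set (E := exp (- b * (t - t0))) in *.
      assert (EC : 0 < E * C) by (apply Rmult_lt_0_compat; auto; apply exp_pos).
      destruct (Hf t Tt Ht t Hsg ((a - b) * (E * C))) as (d & Hd & Hb).
      { apply Rmult_lt_0_compat; lra. }
      (* Steps shorter than [/ a] keep [1 - a * h] nonnegative, so that the bound on [f t] can be
         multiplied by it. *)
      exists (Rmin d (/ a)); split.
      { apply Rmin_glb_lt; auto. apply Rinv_0_lt_compat; lra. }
      intros s Ts Hs.
      pose proof (Rmin_l d (/ a)); pose proof (Rmin_r d (/ a)).
      assert (Hb' : Rabs (f t - f s - v t * (t - s)) <= (a - b) * (E * C) * Rabs (t - s)).
      { apply Hb; [split; [assumption|lra]|apply Rabs_def1; lra]. }
      rewrite (Hexp s t); fold E.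
      specialize (Hv t Tt Ht); specialize (Hpos t Tt Ht).
      rewrite (Rabs_left (t - s)) in Hb' by lra.
      apply Rabs_le_between in Hb'.
      set (h := s - t) in *.
      assert (hp : 0 < h) by (unfold h; lra).
      assert (ha : a * h <= 1).
      { assert (h < / a) by (unfold h; lra).
        assert (a * h <= a * / a) by (apply Rmult_le_compat_l; lra).
        rewrite Rinv_r in H2 by lra; lra. }
      replace (- (t - s)) with h in Hb' by (unfold h; ring).
      replace (t - s) with (- h) in Hb' by (unfold h; ring).
      pose proof (exp_ineq1_le (- b * h)) as Hx.
      assert (v t * h <= - a * f t * h) by (apply Rmult_le_compat_r; lra).
      assert (f s <= f t * (1 - a * h) + (a - b) * (E * C) * h) by lra.
      assert (f t * (1 - a * h) <= E * C * (1 - a * h)) by nra.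
      assert (E * C * (1 - b * h) <= E * C * exp (- b * h)) by nra.
      nra.
    - intros t Tt Ht Happ.
      apply le_epsilon; intros e He'.
      assert (Hc : forall e, 0 < e -> exists d, 0 < d /\ forall s, t - d < s < t ->
                exp (- b * (s - t0)) * C < exp (- b * (t - t0)) * C + e).
      { intros e1 He1.
        assert (Hcont : continuity_pt (fun s => exp (- b * (s - t0)) * C) t) by reg.
        destruct (Hcont e1 He1) as (d & Hd & Hb).
        exists d; split; auto; intros s Hs.
        assert (Hb' : R_dist (exp (- b * (s - t0)) * C) (exp (- b * (t - t0)) * C) < e1).
        { apply Hb; split; [split; [exact I|lra]|].
          simpl; unfold R_dist; apply Rabs_def1; lra. }
        unfold R_dist in Hb'; apply Rabs_def2 in Hb'; lra. }
      destruct (Hc (e / 2)) as (d1 & Hd1 & Hb1); [lra|].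
      destruct (delta_deriv_continuous f t (v t) Hinf (conj Tt (Rlt_le _ _ Ht))
        (Hf t Tt (Rlt_le _ _ Ht)) (e / 2) ltac:(lra)) as (d & Hd & Hb).
      destruct (Happ (Rmin d d1)) as (s & Ts & Hs0 & Hs & IH).
      { apply Rmin_glb_lt; auto. }
      pose proof (Rmin_l d d1); pose proof (Rmin_r d d1).
      assert (Hb' : Rabs (f s - f t) < e / 2).
      { apply Hb; [split; assumption|apply Rabs_def1; lra]. }
      specialize (Hb1 s ltac:(lra)).
      apply Rabs_def2 in Hb'; lra. }
  (* Let [C] decrease to [f t0]: the exponential factor is at most 1, so the excess is at most
     [e]. *)
  apply le_epsilon; intros e He.
  specialize (Key (f t0 + e) ltac:(lra)).
  assert (exp (- b * (t - t0)) <= 1).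
  { rewrite <- exp_0; destruct (Req_dec t t0) as [->|].
    - rewrite Rminus_diag, Rmult_0_r; lra.
    - left; apply exp_increasing; nra. }
  nra.
Qed.

End DeltaDerivative.

(** * Generalized monomials and existence of solutions *)

Section Monomials.

Variables (T : R -> Prop) (t0 : R).

(* Lower sums over chains in [T] from [t0]: their supremum is the delta integral
   when [h] is nonnegative and nondecreasing, as all monomials are. *)
Inductive chain_sum (h : R -> R) : R -> R -> Prop :=
| chain_start : chain_sum h t0 0
| chain_step r u a :
    chain_sum h r a -> T u -> r <= u -> chain_sum h u (a + h r * (u - r)).

Definition delta_integral (h : R -> R) (t : R) : R :=
  real (Lub_Rbar (chain_sum h t)).

(** On the real line these are [(t - t0)^k / k!], on the integers the binomial coefficients of
    [t - t0] over [k]. *)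
Fixpoint monomial (k : nat) : R -> R :=
  match k with
  | O => fun _ => 1
  | S k' => delta_integral (monomial k')
  end.

Hypothesis T0 : T t0.

Lemma chain_sum_dom h u a : chain_sum h u a -> T u /\ t0 <= u.
Proof. induction 1; split; auto; lra. Qed.

(** * Delta integral of a nonnegative nondecreasing function *)

Section Integral.

Variable h : R -> R.
Hypothesis h_pos : forall r, T r -> t0 <= r -> 0 <= h r.
Hypothesis h_mono : forall r s, T r -> t0 <= r -> T s -> r <= s -> h r <= h s.

Lemma chain_sum_bound u a : chain_sum h u a -> 0 <= a <= h u * (u - t0).
Proof.
  induction 1 as [|r u a Hc IH Tu Hru]; [lra|].
  destruct (chain_sum_dom _ _ _ Hc) as [Tr Hr].
  pose proof (h_pos r Tr Hr); pose proof (h_mono r u Tr Hr Tu Hru).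
  assert (0 <= h r * (u - r)) by (apply Rmult_le_pos; lra).
  assert (h r * (u - t0) <= h u * (u - t0)) by (apply Rmult_le_compat_r; lra).
  lra.
Qed.

(** The extended supremum is finite: [h u * (u - t0)] bounds all chain sums, and the one-step chain
    shows that there are some. *)
Lemma delta_integral_lub u :
  T u -> t0 <= u -> is_lub (chain_sum h u) (delta_integral h u).
Proof.
  intros Tu Hu.
  assert (C : chain_sum h u (0 + h t0 * (u - t0))) by
    (apply chain_step; auto; apply chain_start).
  unfold delta_integral.
  destruct (Lub_Rbar_correct (chain_sum h u)) as [H1 H2].
  destruct (Lub_Rbar (chain_sum h u)) as [l| |].
  - split.
    + intros a Ha; apply (H1 a Ha).
    + intros b Hb; apply (H2 (Finite b)); intros a Ha; apply Hb; auto.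
  - exfalso; apply (H2 (Finite (h u * (u - t0)))).
    intros a Ha; apply (chain_sum_bound u a Ha).
  - exfalso; apply (H1 _ C).
Qed.

(** Every chain ending at [s] extends by a single step to [t]. *)
Lemma delta_integral_lower s t :
  T s -> t0 <= s -> T t -> s <= t ->
  delta_integral h s + h s * (t - s) <= delta_integral h t.
Proof.
  intros Ts Hs Tt Hst.
  destruct (delta_integral_lub s Ts Hs) as [_ H2].
  destruct (delta_integral_lub t Tt) as [H1 _]; [lra|].
  assert (delta_integral h s <= delta_integral h t - h s * (t - s)); [|lra].
  apply H2; intros a Ha.
  pose proof (H1 _ (chain_step h s t a Ha Tt Hst)); lra.
Qed.

Lemma delta_integral_mono s t :
  T s -> t0 <= s -> T t -> s <= t -> delta_integral h s <= delta_integral h t.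
Proof.
  intros Ts Hs Tt Hst; pose proof (delta_integral_lower s t Ts Hs Tt Hst).
  pose proof (h_pos s Ts Hs).
  assert (0 <= h s * (t - s)) by (apply Rmult_le_pos; lra); lra.
Qed.

Lemma delta_integral_pos t : T t -> t0 <= t -> 0 <= delta_integral h t.
Proof.
  intros Tt Ht; destruct (delta_integral_lub t Tt Ht) as [H1 _].
  pose proof (H1 _ (chain_step h t0 t 0 (chain_start h) Tt Ht)).
  pose proof (h_pos t0 T0 (Rle_refl _)).
  assert (0 <= h t0 * (t - t0)) by (apply Rmult_le_pos; lra); lra.
Qed.

(** Cut the chain at [s]. The part before is a chain sum ending at [s], and each later step adds at
    most [M] times its length. For the step straddling [s], monotonicity gives [h r <= h s <= M]. *)
Lemma chain_sum_upper s M u a :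
  T s -> t0 <= s -> chain_sum h u a -> s <= u ->
  (forall r, T r -> s <= r < u -> h r <= M) ->
  a <= delta_integral h s + M * (u - s).
Proof.
  intros Ts Hs Hc; induction Hc as [|r u a Hc IH Tu Hru]; intros Hsu HM.
  - pose proof (delta_integral_pos s Ts Hs). replace t0 with s by lra. lra.
  - destruct (chain_sum_dom _ _ _ Hc) as [Tr Hr].
    destruct (Rle_lt_dec s r) as [Hsr|Hsr].
    + specialize (IH Hsr ltac:(intros; apply HM; auto; lra)).
      destruct (Req_dec r u) as [->|N]; [lra|].
      assert (h r <= M) by (apply HM; auto; lra).
      assert (h r * (u - r) <= M * (u - r)) by (apply Rmult_le_compat_r; lra).
      lra.
    + destruct (delta_integral_lub s Ts Hs) as [H1 _].
      pose proof (H1 _ (chain_step h r s a Hc Ts ltac:(lra))).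
      destruct (Req_dec s u) as [<-|N]; [lra|].
      assert (h r <= M).
      { apply Rle_trans with (h s); [apply h_mono; auto; lra|apply HM; auto; lra]. }
      assert (h r * (u - s) <= M * (u - s)) by (apply Rmult_le_compat_r; lra).
      lra.
Qed.

Lemma delta_integral_upper s M t :
  T s -> t0 <= s -> T t -> s <= t ->
  (forall r, T r -> s <= r < t -> h r <= M) ->
  delta_integral h t <= delta_integral h s + M * (t - s).
Proof.
  intros Ts Hs Tt Hst HM.
  destruct (delta_integral_lub t Tt) as [_ H2]; [lra|].
  apply H2; intros a Ha; apply chain_sum_upper; auto.
Qed.

End Integral.

(** * Monotonicity, increments and growth of the monomials *)

Lemma monomial_pos_mono k :
  (forall r, T r -> t0 <= r -> 0 <= monomial k r) /\
  (forall r s, T r -> t0 <= r -> T s -> r <= s -> monomial k r <= monomial k s).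
Proof.
  induction k as [|k [IH1 IH2]]; cbn; [split; intros; lra|].
  split; intros; [apply delta_integral_pos|apply delta_integral_mono]; auto.
Qed.

Lemma monomial_pos k r : T r -> t0 <= r -> 0 <= monomial k r.
Proof. apply monomial_pos_mono. Qed.

Lemma monomial_mono k r s :
  T r -> t0 <= r -> T s -> r <= s -> monomial k r <= monomial k s.
Proof. apply monomial_pos_mono. Qed.

Lemma monomial_lower k s t :
  T s -> t0 <= s -> T t -> s <= t ->
  monomial (S k) s + monomial k s * (t - s) <= monomial (S k) t.
Proof.
  apply delta_integral_lower; [apply monomial_pos|apply monomial_mono].
Qed.

Lemma monomial_upper k s t :
  T s -> t0 <= s -> T t -> s <= t ->
  monomial (S k) t <= monomial (S k) s + monomial k t * (t - s).
Proof.
  intros Ts Hs Tt Hst.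
  apply delta_integral_upper; auto; [apply monomial_pos|apply monomial_mono|].
  intros r Tr Hr; apply monomial_mono; auto; lra.
Qed.

(** No point of [T] lies strictly between [t] and [sg], so on [[t, sg)] the integrand takes only its
    value at [t], and the upper and lower bounds agree. *)
Lemma monomial_jump k t sg :
  T t -> t0 <= t -> T sg -> is_sigma T t sg ->
  monomial (S k) sg = monomial (S k) t + monomial k t * (sg - t).
Proof.
  intros Tt Ht Tsg Hsg; pose proof (sigma_ge _ _ _ Hsg) as Hge.
  apply Rle_antisym; [|apply monomial_lower; auto].
  apply delta_integral_upper; auto; [apply monomial_pos|apply monomial_mono|].
  intros r Tr Hr; destruct (Req_dec r t) as [E|N]; [rewrite E; apply Rle_refl|].
  assert (t < r) by (destruct Hr as [[|E] _]; congruence).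
  pose proof (sigma_le T t sg r Hsg Tr H); lra.
Qed.

Lemma monomial_at_origin k : monomial (S k) t0 = 0.
Proof.
  apply Rle_antisym; [|apply monomial_pos; auto; lra].
  destruct (delta_integral_lub (monomial k) (monomial_pos k) (monomial_mono k)
              t0 T0 (Rle_refl _)) as [_ H2].
  apply H2; intros a Ha.
  pose proof (chain_sum_bound _ (monomial_pos k) (monomial_mono k) _ _ Ha).
  rewrite Rminus_diag in H; lra.
Qed.

(** A left-endpoint step for the increasing function [(k + 1) x^k] lies below the increment of its
    primitive; chain sums are compared with powers through it. *)
Lemma pow_diff_ge k r u :
  0 <= r <= u -> INR (S k) * r ^ k * (u - r) <= u ^ S k - r ^ S k.
Proof.
  intros Hr; induction k as [|k IH]; [cbn; lra|].
  assert (0 <= r ^ k) by (apply pow_le; lra).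
  assert (0 <= u ^ S k - r ^ S k).
  { assert (r ^ S k <= u ^ S k) by (apply pow_incr; lra); lra. }
  assert (INR (S (S k)) = INR (S k) + 1) as -> by apply S_INR.
  assert (r * (INR (S k) * r ^ k * (u - r)) <= r * (u ^ S k - r ^ S k))
    by (apply Rmult_le_compat_l; lra).
  assert (r * (u ^ S k - r ^ S k) <= u * (u ^ S k - r ^ S k))
    by (apply Rmult_le_compat_r; lra).
  change (u ^ S (S k)) with (u * u ^ S k).
  change (r ^ S (S k)) with (r * r ^ S k).
  replace (r ^ S k) with (r * r ^ k) in * by reflexivity.
  lra.
Qed.

(** Comparison with the real line: each chain step adds at most the increment of
    [(u - t0)^(k + 1) / (k + 1)!], and these increments telescope. *)
Lemma monomial_le k t :
  T t -> t0 <= t -> monomial k t <= (t - t0) ^ k * / INR (fact k).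
Proof.
  revert t; induction k as [|k IH]; intros t Tt Ht; [cbn; lra|].
  destruct (delta_integral_lub (monomial k) (monomial_pos k) (monomial_mono k)
              t Tt Ht) as [_ H2].
  apply H2; intros a Ha; clear H2 Tt Ht.
  assert (Hf : 0 < / INR (fact (S k))) by (apply Rinv_0_lt_compat, INR_fact_lt_0).
  induction Ha as [|r u a Hc IHc Tu Hru].
  - rewrite Rminus_diag, pow_i by lia; lra.
  - destruct (chain_sum_dom _ _ _ Hc) as [Tr Hr].
    specialize (IH r Tr Hr).
    pose proof (pow_diff_ge k (r - t0) (u - t0) ltac:(lra)) as HP.
    replace (u - t0 - (r - t0)) with (u - r) in HP by ring.
    assert (E : / INR (fact k) = INR (S k) * / INR (fact (S k))).
    { rewrite fact_simpl, mult_INR; field; split; [apply INR_fact_neq_0|].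
      apply not_0_INR; lia. }
    rewrite E in IH.
    apply (Rmult_le_compat_r (u - r)) in IH; [|lra].
    apply (Rmult_le_compat_r (/ INR (fact (S k)))) in HP; [|lra].
    lra.
Qed.

(** * Series in the monomials and their delta derivatives *)

Definition mono_series (a : nat -> R) (t : R) : R :=
  Series (fun k => monomial k t * a k).

(** The growth of the coefficients of [A^k x0]; with the factorial bound on monomials it makes an
    exponential series dominate. *)
Definition geom_bounded (C c : R) (a : nat -> R) : Prop :=
  forall k, Rabs (a k) <= C * c ^ k.

Lemma geom_bounded_shift C c a :
  geom_bounded C c a -> geom_bounded (C * c) c (fun k => a (S k)).
Proof. intros H k; eapply Rle_trans; [apply H|]; cbn; lra. Qed.

Lemma is_series_exp C x :
  is_series (fun k => C * (x ^ k * / INR (fact k))) (C * exp x).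
Proof.
  apply (is_series_scal C (fun k => x ^ k * / INR (fact k)) (exp x)).
  apply is_series_ext with (fun k => scal (pow_n x k) (/ INR (fact k))).
  - intros k; rewrite pow_n_pow; reflexivity.
  - apply (is_exp_Reals x).
Qed.

Lemma is_series_R0 : is_series (fun _ : nat => 0) 0.
Proof.
  pose proof (is_series_exp 0 0) as H; rewrite Rmult_0_l in H.
  revert H; apply is_series_ext; intros k; apply Rmult_0_l.
Qed.

Lemma mono_term_bound C c a t k :
  0 <= c -> geom_bounded C c a -> T t -> t0 <= t ->
  Rabs (monomial k t * a k) <= C * ((c * (t - t0)) ^ k * / INR (fact k)).
Proof.
  intros Hc Ha Tt Ht.
  pose proof (monomial_pos k t Tt Ht); pose proof (monomial_le k t Tt Ht).
  rewrite Rabs_mult, (Rabs_right (monomial k t)), Rpow_mult_distr by lra.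
  apply Rle_trans with ((t - t0) ^ k * / INR (fact k) * (C * c ^ k)); [|lra].
  apply Rmult_le_compat; auto; apply Rabs_pos.
Qed.

Lemma ex_mono_series_abs C c a t :
  0 <= c -> geom_bounded C c a -> T t -> t0 <= t ->
  ex_series (fun k => Rabs (monomial k t * a k)).
Proof.
  intros Hc Ha Tt Ht.
  apply (ex_series_le (V := R_CompleteNormedModule) _
    (fun k => C * ((c * (t - t0)) ^ k * / INR (fact k)))).
  - intros k; change (Rabs (Rabs (monomial k t * a k)) <=
                      C * ((c * (t - t0)) ^ k * / INR (fact k))).
    rewrite Rabs_Rabsolu; apply mono_term_bound; auto.
  - exists (C * exp (c * (t - t0))); apply is_series_exp.
Qed.

Lemma ex_mono_series C c a t :
  0 <= c -> geom_bounded C c a -> T t -> t0 <= t ->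
  ex_series (fun k => monomial k t * a k).
Proof. intros; apply ex_series_Rabs; eapply ex_mono_series_abs; eauto. Qed.

Lemma mono_series_origin a : mono_series a t0 = a 0%nat.
Proof.
  unfold mono_series.
  apply is_series_unique.
  apply is_series_decr_1.
  match goal with |- is_series _ ?l => replace l with 0 end.
  2: { unfold plus, opp; cbn; ring. }
  apply is_series_ext with (fun _ => 0).
  - intros k; rewrite monomial_at_origin; symmetry; apply Rmult_0_l.
  - apply is_series_R0.
Qed.

Lemma mono_series_incr C c a t :
  0 <= c -> geom_bounded C c a -> T t -> t0 <= t ->
  mono_series a t = a 0%nat + Series (fun k => monomial (S k) t * a (S k)) /\
  ex_series (fun k => monomial (S k) t * a (S k)).
Proof.
  intros Hc Ha Tt Ht; pose proof (ex_mono_series C c a t Hc Ha Tt Ht) as E.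
  split.
  - unfold mono_series; rewrite Series_incr_1 by exact E; cbn; ring.
  - apply (ex_series_incr_1 (fun k => monomial k t * a k)); exact E.
Qed.

Lemma mono_series_jump C c a t sg :
  0 <= c -> geom_bounded C c a -> T t -> t0 <= t -> T sg -> is_sigma T t sg ->
  mono_series a sg = mono_series a t + mono_series (fun k => a (S k)) t * (sg - t).
Proof.
  intros Hc Ha Tt Ht Tsg Hsg; pose proof (sigma_ge _ _ _ Hsg) as Hge.
  destruct (mono_series_incr C c a t Hc Ha Tt Ht) as [-> E1].
  destruct (mono_series_incr C c a sg Hc Ha Tsg ltac:(lra)) as [-> E2].
  pose proof (ex_mono_series _ c _ t Hc (geom_bounded_shift C c a Ha) Tt Ht) as E3.
  unfold mono_series; rewrite <- Series_scal_r, Rplus_assoc, <- Series_plus; auto.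
  2: { apply ex_series_scal_r; exact E3. }
  f_equal; apply Series_ext; intros k; rewrite (monomial_jump k t sg); auto; ring.
Qed.

Lemma Series_dominated_exp (u : nat -> R) C x :
  (forall k, Rabs (u k) <= C * (x ^ k * / INR (fact k))) ->
  Rabs (Series u) <= C * exp x.
Proof.
  intros H.
  assert (E : ex_series (fun k => Rabs (u k))).
  { apply (ex_series_le (V := R_CompleteNormedModule) _
      (fun k => C * (x ^ k * / INR (fact k)))).
    - intros k; change (Rabs (Rabs (u k)) <= C * (x ^ k * / INR (fact k))).
      rewrite Rabs_Rabsolu; auto.
    - exists (C * exp x); apply is_series_exp. }
  eapply Rle_trans; [apply Series_Rabs; exact E|].
  rewrite <- (is_series_unique _ _ (is_series_exp C x)).
  apply Series_le; [intros k; split; [apply Rabs_pos|apply H]|].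
  exists (C * exp x); apply is_series_exp.
Qed.

Lemma mono_series_lipschitz C c a s t :
  0 <= c -> geom_bounded C c a -> T s -> t0 <= s -> T t -> s <= t ->
  Rabs (mono_series a t - mono_series a s) <= C * c * (t - s) * exp (c * (t - t0)).
Proof.
  intros Hc Ha Ts Hs Tt Hst.
  assert (Ht : t0 <= t) by lra.
  destruct (mono_series_incr C c a s Hc Ha Ts Hs) as [-> E1].
  destruct (mono_series_incr C c a t Hc Ha Tt Ht) as [-> E2].
  match goal with |- Rabs (?z + ?x - (?z + ?y)) <= _ =>
    replace (z + x - (z + y)) with (x - y) by ring end.
  rewrite <- Series_minus by auto.
  apply Series_dominated_exp; intros k.
  rewrite <- Rmult_minus_distr_r, Rabs_mult.
  pose proof (monomial_upper k s t Ts Hs Tt Hst).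
  pose proof (monomial_mono (S k) s t Ts Hs Tt Hst).
  rewrite (Rabs_right (monomial (S k) t - monomial (S k) s)) by lra.
  apply Rle_trans with (monomial k t * (t - s) * Rabs (a (S k))).
  { apply Rmult_le_compat_r; [apply Rabs_pos|lra]. }
  pose proof (mono_term_bound (C * c) c _ t k Hc (geom_bounded_shift C c a Ha) Tt Ht)
    as B; cbn beta in B.
  pose proof (monomial_pos k t Tt Ht).
  rewrite Rabs_mult, (Rabs_right (monomial k t)) in B by lra.
  apply (Rmult_le_compat_r (t - s)) in B; lra.
Qed.

(** Term by term: the first-order remainder of the monomial of degree [k + 2] is at most the
    increment of degree [k + 1] times [t - s], hence at most [monomial k t * (t - s) ^ 2]. *)
Lemma mono_series_taylor C c a s t :
  0 <= c -> geom_bounded C c a -> T s -> t0 <= s -> T t -> s <= t ->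
  Rabs (mono_series a t - mono_series a s
        - mono_series (fun k => a (S k)) s * (t - s))
    <= C * c * c * (t - s) ^ 2 * exp (c * (t - t0)).
Proof.
  intros Hc Ha Ts Hs Tt Hst.
  assert (Ht : t0 <= t) by lra.
  pose proof (geom_bounded_shift C c a Ha) as Ha1.
  pose proof (geom_bounded_shift _ c _ Ha1) as Ha2; cbn beta in Ha2.
  destruct (mono_series_incr C c a s Hc Ha Ts Hs) as [-> E1].
  destruct (mono_series_incr C c a t Hc Ha Tt Ht) as [-> E2].
  pose proof (ex_mono_series _ c _ s Hc Ha1 Ts Hs) as E3.
  match goal with |- Rabs (?z + ?x - (?z + ?y) - ?w) <= _ =>
    replace (z + x - (z + y) - w) with (x - y - w) by ring end.
  unfold mono_series; rewrite <- Series_scal_r.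
  assert (E4 : ex_series (fun k => monomial k s * a (S k) * (t - s)))
    by (apply ex_series_scal_r; exact E3).
  rewrite <- Series_minus by auto.
  rewrite <- Series_minus; auto; [|apply (ex_series_minus (V := R_NormedModule)); auto].
  assert (E5 : ex_series (fun k => monomial (S k) t * a (S k) -
            monomial (S k) s * a (S k) - monomial k s * a (S k) * (t - s))).
  { apply (ex_series_minus (V := R_NormedModule)); auto.
    apply (ex_series_minus (V := R_NormedModule)); auto. }
  rewrite Series_incr_1 by exact E5.
  (* The monomial of degree 1 grows exactly by [t - s], so its remainder vanishes and the series
     starts at degree 2. *)
  replace (monomial 1 t * a 1%nat - monomial 1 s * a 1%nat -
           monomial 0 s * a 1%nat * (t - s)) with 0.
  2: { pose proof (monomial_upper 0 s t Ts Hs Tt Hst) as U.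
       pose proof (monomial_lower 0 s t Ts Hs Tt Hst) as L.
       change (monomial 0 t) with 1 in *; change (monomial 0 s) with 1 in *.
       replace (monomial 1 t) with (monomial 1 s + (t - s)) by lra. ring. }
  rewrite Rplus_0_l.
  apply Series_dominated_exp; intros k.
  replace (monomial (S (S k)) t * a (S (S k)) - monomial (S (S k)) s * a (S (S k)) -
     monomial (S k) s * a (S (S k)) * (t - s)) with
   ((monomial (S (S k)) t - monomial (S (S k)) s - monomial (S k) s * (t - s))
     * a (S (S k))) by ring.
  rewrite Rabs_mult.
  pose proof (monomial_lower (S k) s t Ts Hs Tt Hst).
  pose proof (monomial_upper (S k) s t Ts Hs Tt Hst).
  pose proof (monomial_upper k s t Ts Hs Tt Hst).
  pose proof (monomial_mono (S k) s t Ts Hs Tt Hst).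
  pose proof (monomial_pos k t Tt Ht).
  rewrite Rabs_right by lra.
  apply Rle_trans with (monomial k t * (t - s) ^ 2 * Rabs (a (S (S k)))).
  { apply Rmult_le_compat_r; [apply Rabs_pos|].
    assert ((monomial (S k) t - monomial (S k) s) * (t - s)
            <= monomial k t * (t - s) * (t - s))
      by (apply Rmult_le_compat_r; lra).
    cbn [pow]; lra. }
  pose proof (mono_term_bound _ c _ t k Hc Ha2 Tt Ht) as B; cbn beta in B.
  rewrite Rabs_mult, (Rabs_right (monomial k t)) in B by lra.
  apply (Rmult_le_compat_r ((t - s) ^ 2)) in B; [lra|apply pow2_ge_0].
Qed.

(** Differentiation shifts the coefficients, as each monomial is the integral of the previous one.
    The jump formula moves [sg] back to [t], and the Taylor bound makes the error quadratic in
    [s - t]. *)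
Lemma mono_series_delta_deriv C c a t :
  is_closed_set T -> 0 <= C -> 0 <= c -> geom_bounded C c a -> T t -> t0 <= t ->
  delta_deriv_on (fun s => T s /\ t0 <= s) T (mono_series a) t
    (mono_series (fun k => a (S k)) t).
Proof.
  intros HT HC Hc Ha Tt Ht sg Hsg eps He.
  pose proof (sigma_ge _ _ _ Hsg) as Hge.
  pose proof (sigma_in _ _ _ HT Hsg) as Tsg.
  pose proof (geom_bounded_shift C c a Ha) as Ha1.
  rewrite (mono_series_jump C c a t sg) by auto.
  (* One constant serves all Taylor and Lipschitz bounds up to time [t + 1]. *)
  set (L := C * c * c * exp (c * (t + 1 - t0))).
  assert (HL : 0 <= L).
  { unfold L; repeat apply Rmult_le_pos; auto; left; apply exp_pos. }
  assert (Hexp : forall u, u <= t + 1 -> exp (c * (u - t0)) <= exp (c * (t + 1 - t0))).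
  { intros u Hu.
    destruct (Rle_lt_or_eq_dec (c * (u - t0)) (c * (t + 1 - t0))) as [|E].
    - apply Rmult_le_compat_l; lra.
    - left; apply exp_increasing; auto.
    - rewrite E; lra. }
  assert (HLb : forall u x, u <= t + 1 -> 0 <= x ->
            C * c * c * x * exp (c * (u - t0)) <= L * x).
  { intros u x Hu Hx; unfold L.
    replace (C * c * c * exp (c * (t + 1 - t0)) * x) with
      (C * c * c * x * exp (c * (t + 1 - t0))) by ring.
    apply Rmult_le_compat_l; auto; repeat apply Rmult_le_pos; auto. }
  set (d1 := eps / (2 * L + 1)).
  assert (Hd1 : 0 < d1) by (apply Rdiv_lt_0_compat; lra).
  assert (HLd : 2 * L * d1 <= eps).
  { unfold d1. replace (2 * L * (eps / (2 * L + 1))) with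
      (eps * (2 * L / (2 * L + 1))) by (field; lra).
    assert (2 * L / (2 * L + 1) <= 1) by (apply Rle_div_l; lra). nra. }
  (* If [t] is right-scattered, [d <= sg - t] keeps every later point of [T] out of the window. *)
  assert (Hd : exists d, 0 < d /\ d <= d1 /\ d <= 1 /\
                (t < sg -> d <= sg - t)).
  { destruct Hge as [Hlt|Heq].
    - exists (Rmin (Rmin d1 1) (sg - t)).
      pose proof (Rmin_l (Rmin d1 1) (sg - t)).
      pose proof (Rmin_r (Rmin d1 1) (sg - t)).
      pose proof (Rmin_l d1 1). pose proof (Rmin_r d1 1).
      repeat split; try lra. repeat apply Rmin_glb_lt; lra.
    - exists (Rmin d1 1).
      pose proof (Rmin_l d1 1). pose proof (Rmin_r d1 1).
      repeat split; try lra. repeat apply Rmin_glb_lt; lra. }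
  destruct Hd as (d & Hd & Hdd1 & Hdone & Hdsg).
  exists d; split; auto; intros s [Ts Hs] Hst.
  apply Rabs_def2 in Hst.
  set (F := mono_series a) in *; set (F' := mono_series (fun k => a (S k))) in *.
  destruct (Rle_lt_dec s t) as [Hle|Hlt].
  (* The Taylor bound is based at the earlier point [s]; replacing [F' s] by [F' t] costs a
     Lipschitz term, whence the factor 2 in [2 * L]. *)
  - replace (F t + F' t * (sg - t) - F s - F' t * (sg - s)) with
      ((F t - F s - F' s * (t - s)) + - ((F' t - F' s) * (t - s))) by ring.
    pose proof (mono_series_taylor C c a s t Hc Ha Ts Hs Tt Hle) as B1.
    pose proof (mono_series_lipschitz _ c _ s t Hc Ha1 Ts Hs Tt Hle) as B2.
    fold F F' in B1, B2.
    eapply Rle_trans; [apply Rabs_triang|].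
    rewrite Rabs_Ropp, Rabs_mult, (Rabs_right (t - s)), (Rabs_right (sg - s)) by lra.
    apply (Rmult_le_compat_r (t - s)) in B2; [|lra].
    pose proof (HLb t ((t - s) ^ 2) ltac:(lra) (pow2_ge_0 _)) as B3.
    assert (2 * L * (t - s) ^ 2 <= eps * (t - s)).
    { replace (2 * L * (t - s) ^ 2) with (2 * L * (t - s) * (t - s)) by ring.
      apply Rmult_le_compat_r; [lra|].
      apply Rle_trans with (2 * L * d1); auto.
      apply Rmult_le_compat_l; lra. }
    assert (eps * (t - s) <= eps * (sg - s)) by (apply Rmult_le_compat_l; lra).
    lra.
  - assert (sg = t) as ->.
    { destruct Hge as [Hg|]; auto.
      pose proof (sigma_le _ _ _ _ Hsg Ts Hlt). specialize (Hdsg Hg). lra. }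
    replace (F t + F' t * (t - t) - F s - F' t * (t - s)) with
      (- (F s - F t - F' t * (s - t))) by ring.
    rewrite Rabs_Ropp, (Rabs_left (t - s)) by lra.
    pose proof (mono_series_taylor C c a t s Hc Ha Tt Ht Ts ltac:(lra)) as B1.
    fold F F' in B1.
    pose proof (HLb s ((s - t) ^ 2) ltac:(lra) (pow2_ge_0 _)) as B3.
    assert (L * (s - t) ^ 2 <= eps * (s - t)); [|lra].
    replace (L * (s - t) ^ 2) with (L * (s - t) * (s - t)) by ring.
    apply Rmult_le_compat_r; [lra|].
    apply Rle_trans with (2 * L * d1); auto.
    assert (L * (s - t) <= L * d1) by (apply Rmult_le_compat_l; lra).
    assert (0 <= L * d1) by (apply Rmult_le_pos; lra).
    lra.
Qed.

(** * Solution of the initial value problem and its integral *)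

Variables (n : nat) (A : nat -> nat -> R) (x0 : nat -> R).

Fixpoint matpow_vec (k : nat) : nat -> R :=
  match k with
  | O => x0
  | S k' => matvec n A (matpow_vec k')
  end.

Definition ivp_solution (t : R) (i : nat) : R :=
  mono_series (fun k => matpow_vec k i) t.

(** Prepending a zero coefficient integrates the solution from [t0], since differentiation shifts it
    away again. *)
Definition ivp_integral (t : R) (i : nat) : R :=
  mono_series (fun k => match k with O => 0 | S k' => matpow_vec k' i end) t.

Let C := vsum n (fun i => Rabs (x0 i)).
(** The sum dominates every absolute row sum; the [1 +] gives [1 <= c], so the sequence with a
    prepended zero obeys the same bound. *)
Let c := 1 + vsum n (fun i => vsum n (fun j => Rabs (A i j))).

Lemma bound_const_pos : 0 <= C /\ 1 <= c.
Proof.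
  split; [apply vsum_nonneg; intros; apply Rabs_pos|].
  assert (0 <= vsum n (fun i => vsum n (fun j => Rabs (A i j)))); [|unfold c; lra].
  apply vsum_nonneg; intros; apply vsum_nonneg; intros; apply Rabs_pos.
Qed.

Lemma matpow_vec_geom i : (i < n)%nat -> geom_bounded C c (fun k => matpow_vec k i).
Proof.
  intros Hi k; destruct bound_const_pos as [HC Hc].
  revert i Hi; induction k as [|k IH]; intros i Hi; cbn.
  - rewrite Rmult_1_r; unfold C.
    apply (vsum_ge_term n (fun i => Rabs (x0 i))); auto; intros; apply Rabs_pos.
  - unfold matvec; eapply Rle_trans; [apply Rabs_vsum|].
    assert (Hck : 0 <= C * c ^ k) by (apply Rmult_le_pos; auto; apply pow_le; lra).
    apply Rle_trans with (vsum n (fun j => (C * c ^ k) * Rabs (A i j))).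
    { apply vsum_le; intros j Hj; rewrite Rabs_mult, Rmult_comm.
      apply Rmult_le_compat_r; [apply Rabs_pos|apply IH; auto]. }
    rewrite vsum_scal.
    replace (C * (c * c ^ k)) with (C * c ^ k * c) by ring.
    apply Rmult_le_compat_l; auto.
    pose proof (vsum_ge_term n (fun i => vsum n (fun j => Rabs (A i j))) i Hi) as B.
    cbn beta in B; unfold c.
    assert (vsum n (fun j => Rabs (A i j)) <=
            vsum n (fun i => vsum n (fun j => Rabs (A i j)))); [|lra].
    apply B; intros; apply vsum_nonneg; intros; apply Rabs_pos.
Qed.

Lemma ivp_integral_geom i : (i < n)%nat ->
  geom_bounded C c (fun k => match k with O => 0 | S k' => matpow_vec k' i end).
Proof.
  intros Hi k; destruct bound_const_pos as [HC Hc].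
  destruct k as [|k]; [rewrite Rabs_R0; cbn; lra|].
  eapply Rle_trans; [apply (matpow_vec_geom i Hi k)|].
  cbn; apply Rmult_le_compat_l; auto.
  assert (0 <= c ^ k) by (apply pow_le; lra); nra.
Qed.

Lemma Series_vsum m (f : nat -> nat -> R) :
  (forall j, (j < m)%nat -> ex_series (f j)) ->
  ex_series (fun k => vsum m (fun j => f j k)) /\
  Series (fun k => vsum m (fun j => f j k)) = vsum m (fun j => Series (f j)).
Proof.
  induction m as [|m IH]; intros H; cbn.
  - split; [exists 0|apply is_series_unique]; apply is_series_R0.
  - destruct IH as [E1 E2]; auto.
    split; [apply (ex_series_plus (V := R_NormedModule)); auto|].
    rewrite Series_plus, E2; auto.
Qed.

Lemma mono_series_matvec i t (b : nat -> nat -> R) :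
  (forall j, (j < n)%nat -> geom_bounded C c (fun k => b k j)) ->
  T t -> t0 <= t ->
  mono_series (fun k => matvec n A (b k) i) t
  = matvec n A (fun j => mono_series (fun k => b k j) t) i.
Proof.
  intros Hb Tt Ht; destruct bound_const_pos as [HC Hc].
  unfold mono_series, matvec.
  destruct (Series_vsum n (fun j k => A i j * (monomial k t * b k j))) as [_ E].
  { intros j Hj; apply (ex_series_scal (V := R_NormedModule) (A i j)
      (fun k => monomial k t * b k j)).
    apply (ex_mono_series C c (fun k => b k j)); auto; lra. }
  transitivity (Series (fun k => vsum n (fun j => A i j * (monomial k t * b k j)))).
  { apply Series_ext; intros k; rewrite <- vsum_scal.
    apply vsum_ext; intros; ring. }
  rewrite E; apply vsum_ext; intros j Hj; apply Series_scal_l.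
Qed.

Lemma ivp_solution_correct :
  is_closed_set T -> is_forward_solution T n A t0 ivp_solution.
Proof.
  intros HT t Tt Ht i Hi; destruct bound_const_pos as [HC Hc].
  unfold ivp_solution at 2.
  rewrite <- (mono_series_matvec i t matpow_vec) by (auto using matpow_vec_geom).
  apply (mono_series_delta_deriv C c (fun k => matpow_vec k i)); auto; [lra|].
  apply matpow_vec_geom; auto.
Qed.

Lemma ivp_solution_init i : ivp_solution t0 i = x0 i.
Proof. unfold ivp_solution; rewrite mono_series_origin; reflexivity. Qed.

Lemma ivp_integral_init i : ivp_integral t0 i = 0.
Proof. unfold ivp_integral; rewrite mono_series_origin; reflexivity. Qed.

Lemma ivp_integral_deriv i t :
  is_closed_set T -> (i < n)%nat -> T t -> t0 <= t ->
  delta_deriv_on (fun s => T s /\ t0 <= s) T (fun s => ivp_integral s i) t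
    (ivp_solution t i).
Proof.
  intros HT Hi Tt Ht; destruct bound_const_pos as [HC Hc].
  apply (mono_series_delta_deriv C c
    (fun k => match k with O => 0 | S k' => matpow_vec k' i end)); auto; [lra|].
  apply ivp_integral_geom; auto.
Qed.

(** The integrated equation: without its term [x0], the series of the solution is [A] applied
    coefficientwise to the series of the integral. *)
Lemma ivp_solution_integral i t :
  (i < n)%nat -> T t -> t0 <= t ->
  ivp_solution t i = x0 i + matvec n A (ivp_integral t) i.
Proof.
  intros Hi Tt Ht; destruct bound_const_pos as [HC Hc].
  unfold ivp_integral.
  rewrite <- (mono_series_matvec i t
    (fun k j => match k with O => 0 | S k' => matpow_vec k' j end))
    by (auto using ivp_integral_geom).
  unfold ivp_solution.
  destruct (mono_series_incr C c (fun k => matpow_vec k i) t) as [-> E1]; auto;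
    [lra|apply matpow_vec_geom; auto|].
  cbn [matpow_vec]; f_equal.
  symmetry; unfold mono_series.
  (* The prepended zero coefficient is sent to 0, so the degree 0 term drops out. *)
  assert (Z : matvec n A (fun _ => 0) i = 0).
  { unfold matvec; rewrite (vsum_ext n _ (fun j => 0 * A i j)) by (intros; ring).
    rewrite vsum_scal; ring. }
  apply is_series_unique, is_series_decr_1.
  rewrite Z, Rmult_0_r.
  match goal with |- is_series _ ?l => replace l with
    (Series (fun k => monomial (S k) t * matvec n A (matpow_vec k) i)) end.
  2: { unfold plus, opp; cbn; ring. }
  apply Series_correct; exact E1.
Qed.

End Monomials.

(** * Metzler matrices *)

Module MetzlerMatrices.

Import Rdefinitions Rstruct.
Import all_boot all_order all_algebra perm ring.
Set Implicit Arguments.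
Unset Strict Implicit.
Unset Printing Implicit Defensive.
Import Order.TTheory GRing.Theory Num.Theory.
Local Open Scope ring_scope.

(** * Derivative of the characteristic polynomial *)

Lemma deriv_big_prod (R : comNzRingType) (I : eqType) (s : seq I)
    (F : I -> {poly R}) :
  uniq s ->
  (\prod_(i <- s) F i)^`()
  = \sum_(i <- s) (F i)^`() * \prod_(j <- s | j != i) F j.
Proof.
elim: s => [|a s IH] /=; first by rewrite !big_nil derivC.
case/andP=> a_s s_uniq; rewrite !big_cons derivM IH // eqxx /=.
congr (_ * _ + _).
  rewrite big_seq [RHS]big_seq_cond; apply: eq_bigl => i.
  by case: (boolP (i \in s)) => //= i_s; rewrite (memPn a_s).
rewrite mulr_sumr; apply: eq_big_seq => i i_s.
have ai : a != i by apply: contraNneq a_s => ->.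
by rewrite big_cons ai mulrCA.
Qed.

(** The determinant is differentiated one row at a time. The derivative of row [k] of ['X - B] is
    the [k]-th basis row; the resulting matrix [N k], expanded along that row, leaves one principal
    minor with sign [+]. *)
Lemma deriv_char_poly (R : comNzRingType) n (B : 'M[R]_n.+1) :
  (char_poly B)^`() = \sum_i char_poly (row' i (col' i B)).
Proof.
pose M := char_poly_mx B.
pose N (k : 'I_n.+1) : 'M[{poly R}]_n.+1 :=
  \matrix_(i, j) if i == k then (j == k)%:R else M i j.
have detN k : \det (N k) = char_poly (row' k (col' k B)).
  rewrite (expand_det_row _ k) (bigD1 k) //= big1 => [|j jk].
    rewrite mxE !eqxx mul1r addr0 /cofactor addnn -signr_odd odd_double expr0 mul1r.
    congr (\det _); apply/matrixP=> i j; rewrite !mxE eq_sym (negPf (neq_lift _ _)).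
    by rewrite (inj_eq lift_inj).
  by rewrite mxE eqxx (negPf jk) mul0r.
rewrite -(eq_bigr _ (fun k _ => detN k)) exchange_big /=.
rewrite /char_poly /determinant raddf_sum /=; apply: eq_bigr => s _.
have -> p : ((-1) ^+ s * p)^`() = (-1) ^+ s * (p^`() : {poly R}).
  by case: (s : bool); rewrite ?expr1 ?expr0 ?mulN1r ?mul1r ?derivN.
rewrite -mulr_sumr; congr (_ * _).
rewrite deriv_big_prod ?index_enum_uniq //; apply: eq_bigr => k _.
rewrite [RHS](bigD1 k) //= [X in _ = X * _]mxE eqxx; congr (_ * _).
  rewrite !mxE derivB derivC subr0 eq_sym.
  by case: (s k == k); rewrite ?derivX ?deriv0.
by apply: eq_bigr => j jk; rewrite [RHS]mxE (negPf jk).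
Qed.

(** * Metzler matrices and positive rows [y] with [y B] negative *)

Definition metzler (R : numDomainType) n (B : 'M[R]_n) :=
  forall i j, i != j -> 0 <= B i j.

Section Metzler.

Variable R : rcfType.

(** A maximum principle. If a left eigenvector [w] for [a >= 0] had a positive entry, let [m] be the
    largest ratio [w_i / y_i], attained at [i]. Then [w <= m y] with equality at [i], so
    [a w_i = (w B)_i <= m (y B)_i < 0], which is absurd. Applied to [v] and [- v], this gives
    [v = 0]. *)
Lemma metzler_eigenvalue_lt0 n (B : 'M[R]_n) (y : 'rV[R]_n) (a : R) :
  metzler B -> (forall j, 0 < y 0 j) -> (forall j, (y *m B) 0 j < 0) ->
  root (char_poly B) a -> a < 0.
Proof.
move=> metB y_gt0 yB; rewrite -eigenvalue_root_char => /eigenvalueP[v vB v0].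
rewrite ltNge; apply: contra v0 => a_ge0.
have le0 (w : 'rV[R]_n) : w *m B = a *: w -> forall i, w 0 i <= 0.
  move=> wB i0; rewrite leNgt; apply/negP => wi0.
  case: (@arg_maxP _ _ _ i0 xpredT (fun i => w 0 i / y 0 i)) => // i _ imax.
  set m := w 0 i / y 0 i in imax.
  have m_gt0 : 0 < m by apply: lt_le_trans (imax i0 isT); rewrite divr_gt0.
  have wi : w 0 i = m * y 0 i by rewrite /m divfK ?gt_eqF.
  have wle j : w 0 j <= m * y 0 j by rewrite -ler_pdivrMr //; apply: imax.
  have := congr1 (fun u : 'rV_n => u 0 i) wB; rewrite !mxE => wBi.
  have : a * w 0 i <= m * (y *m B) 0 i.
    rewrite -wBi mxE mulr_sumr; apply: ler_sum => j _; rewrite mulrA.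
    have [->|ji] := eqVneq j i; first by rewrite wi.
    by apply: ler_wpM2r; rewrite ?metB.
  apply/negP; rewrite -ltNge; apply: lt_le_trans (_ : 0 <= _).
    by rewrite pmulr_rlt0.
  by rewrite wi mulr_ge0 // mulr_ge0 // ltW.
apply/eqP/rowP => i; rewrite mxE; apply: le_anti; rewrite le0 //=.
by have := le0 (- v) _ i; rewrite mulNmx scalerN vB mxE oppr_le0; apply.
Qed.

(** Induction on the dimension. A monic polynomial without nonnegative roots is positive at 0, which
    settles [k = 0]. Higher coefficients are read off the derivative, a sum over principal
    submatrices. *)
Lemma metzler_char_poly_coef_gt0 n (B : 'M[R]_n) (y : 'rV[R]_n) k :
  metzler B -> (forall j, 0 < y 0 j) -> (forall j, (y *m B) 0 j < 0) ->
  (k <= n)%N -> 0 < (char_poly B)`_k.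
Proof.
elim: n k B y => [|n IH] k B y metB y_gt0 yB k_le.
  by move: k_le; rewrite leqn0 => /eqP->; rewrite /char_poly det_mx00 coefC.
case: k k_le => [_|k k_le].
  rewrite -horner_coef0 ltNge; apply/negP => le0.
  have [|N HN] := @polyrcf.poly_pinfty_gt_lc R (char_poly B).
    by rewrite (monicP (char_poly_monic B)).
  have := @poly_ivt R (char_poly B) 0 `|N| (normr_ge0 _).
  case; last first.
    move=> x /andP[x_ge0 _] /(metzler_eigenvalue_lt0 metB y_gt0 yB).
    by rewrite ltNge x_ge0.
  rewrite le0 (le_trans _ (HN _ (ler_norm _))) //.
  by rewrite (monicP (char_poly_monic B)).
have : 0 < ((char_poly B)^`())`_k.
  rewrite deriv_char_poly coef_sum big_ord_recl.
  have pos i : 0 < (char_poly (row' i (col' i B)))`_k.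
    (* Deleting index [i] preserves the hypotheses: the term [y_i B_ij] dropped from column [j] is
       nonnegative, so the image stays negative. *)
    { apply: (IH _ _ (col' i y)) => //.
    - by move=> p q pq; rewrite !mxE; apply: metB; rewrite (inj_eq lift_inj).
    - by move=> j; rewrite mxE.
    - move=> j; apply: le_lt_trans (yB (lift i j)).
      rewrite !mxE (bigD1_ord i) //=.
      rewrite -[leLHS]add0r lerD //.
        by rewrite mulr_ge0 ?metB ?neq_lift ?ltW.
      by apply: ler_sum => p _; rewrite !mxE. }
  by rewrite ltr_wpDr // sumr_ge0 // => i _; rewrite ltW.
by rewrite coef_deriv pmulrn_lgt0.
Qed.

Lemma seq_has_max (s : seq R) x :
  x \in s -> exists2 m, m \in s & {in s, forall z, z <= m}.
Proof.
elim: s x => // a s IH x _; case: s IH => [|b s] IH.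
  by exists a; rewrite ?inE // => z; rewrite inE => /eqP->.
have [m ms mmax] := IH b (mem_head _ _).
exists (Num.max a m).
  by rewrite maxElt; case: ifP => _; rewrite inE ?ms ?eqxx ?orbT.
by move=> z; rewrite inE le_max => /orP[/eqP->|/mmax->]; rewrite ?lexx ?orbT.
Qed.

(* The row [1 adj(a - B)] is positive for large [a]. Going down from there, it
   cannot lose positivity while [char_poly B] is positive: at the largest zero [m]
   of an entry [j], the [j]-th component of [y (m - B)] would be nonpositive. *)
Lemma metzler_positive_row n (B : 'M[R]_n) :
  metzler B -> (forall a, 0 <= a -> 0 < (char_poly B).[a]) ->
  exists y : 'rV[R]_n, (forall j, 0 < y 0 j) /\ (forall j, (y *m B) 0 j < 0).
Proof.
move=> metB chi_gt0.
pose Y : 'rV[{poly R}]_n := const_mx 1 *m \adj (char_poly_mx B).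
have YP j : (Y *m char_poly_mx B) 0 j = char_poly B.
  rewrite /Y -mulmxA mul_adj_mx mxE (bigD1 j) //= !mxE eqxx mul1r big1 ?addr0 //.
  by move=> i ij; rewrite !mxE (negPf ij) mulr0.
clearbody Y.
(* The adjugate identity at [a]: every component of [Y (a - B)] equals the characteristic
   polynomial. *)
have YE a j : a * (Y 0 j).[a] - \sum_i (Y 0 i).[a] * B i j = (char_poly B).[a].
  rewrite -(YP j) mxE horner_sum [RHS](bigD1 j) //= [X in _ - X](bigD1 j) //=.
  rewrite !mxE eqxx hornerM !hornerE /= opprD addrA; congr (_ + _); first by ring.
  rewrite -sumrN; apply: eq_bigr => i ij.
  by rewrite !mxE (negPf ij) !hornerE /= mulrN.
pose L := 1 + \sum_i \sum_j `|B i j|.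
have L_gt j : \sum_i B i j < L.
  rewrite /L ltr_pwDl ?ltr01 // ler_sum // => i _.
  rewrite (bigD1 j) //= (le_trans (ler_norm _)) // lerDl sumr_ge0 //.
have L_ge0 : 0 <= L by rewrite addr_ge0 // sumr_ge0 // => i _; rewrite sumr_ge0.
have Y_gt0 a j : L <= a -> 0 < (Y 0 j).[a].
  move=> La.
  (* At the smallest entry [i], replacing all entries by that one gives
     [(a - column sum) * Y_i >= char_poly > 0], and [L] exceeds every column sum. *)
  case: (@arg_minP _ _ _ j xpredT (fun i => (Y 0 i).[a])) => // i _ imin.
  apply: lt_le_trans (imin j isT).
  have := chi_gt0 a (le_trans L_ge0 La); rewrite -(YE a i) => pos.
  have : 0 < (a - \sum_k B k i) * (Y 0 i).[a].
    apply: (lt_le_trans pos); rewrite mulrBl lerB // mulr_suml ler_sum // => k _.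
    have [->|ki] := eqVneq k i; first by rewrite mulrC.
    by rewrite mulrC ler_wpM2r ?metB //; apply: imin.
  by rewrite pmulr_rgt0 // subr_gt0 (lt_le_trans (L_gt i)).
have Y0_gt0 j : 0 < (Y 0 j).[0].
  rewrite ltNge; apply/negP => Yj0.
  (* The product collects the zeros of all entries; it is nonzero because it is positive at [L], so
     it has a largest root. *)
  pose P := \prod_j Y 0 j.
  have rootYP i a : root (Y 0 i) a -> root P a.
    by move=> /rootP r; apply/rootP; rewrite /P horner_prod (bigD1 i) //= r mul0r.
  have P0 : P != 0.
    apply: contraTneq (ltr01 : (0 : R) < 1) => P0; have : P.[L] = 0 by rewrite P0 horner0.
    by move/eqP; rewrite /P horner_prod gt_eqF // prodr_gt0 // => i _; rewrite Y_gt0.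
  have inR a : root P a = (a \in polyrcf.rootsR P).
    by rewrite -(polyrcf.roots_on_rootsR P0) in_itv.
  have [x /andP[x_ge0 _] rx] : exists2 x, 0 <= x <= L & root (Y 0 j) x.
    by apply: poly_ivt; rewrite // Yj0 ltW ?Y_gt0.
  have [m] := seq_has_max (etrans (esym (inR x)) (rootYP _ _ rx)).
  rewrite -inR => rm mmax.
  have m_ge0 : 0 <= m by apply: le_trans x_ge0 (mmax x _); rewrite -inR (rootYP j).
  (* An entry negative at [m] would vanish again beyond [m], being positive at [Num.max m L]. *)
  have Ym_ge0 i : 0 <= (Y 0 i).[m].
    rewrite leNgt; apply/negP => neg.
    have mM : m <= Num.max m L by rewrite le_max lexx.
    have [|z /andP[mz _] rz] := @poly_ivt R (Y 0 i) m (Num.max m L) mM.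
      by rewrite (ltW neg) ltW // Y_gt0 // le_max lexx orbT.
    have zm : z <= m by apply: mmax; rewrite -inR (rootYP i).
    have zE : z = m by apply: le_anti; rewrite zm mz.
    by move: neg; rewrite -zE (rootP rz) ltxx.
  (* For an entry [i] vanishing at [m], the identity [YE] leaves minus a sum of nonnegative
     off-diagonal terms, yet it must be positive. *)
  move: rm; rewrite /root /P horner_prod prodf_seq_eq0 => /hasP[i _ /= /eqP Yi].
  have := chi_gt0 m m_ge0; rewrite -(YE m i) Yi mulr0 sub0r oppr_gt0 ltNge.
  case/negP; apply: sumr_ge0 => k _.
  have [->|ki] := eqVneq k i; first by rewrite Yi mul0r.
  by rewrite mulr_ge0 ?metB.
exists (\row_j (Y 0 j).[0]); split=> [j|j]; first by rewrite mxE.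
have := chi_gt0 0 (lexx _); rewrite -(YE 0 j) mul0r sub0r oppr_gt0 mxE.
by under [X in _ -> X < _]eq_bigr do rewrite mxE.
Qed.

End Metzler.

(** * Transfer to matrices indexed by natural numbers *)

Lemma vsum_bigE m f : vsum m f = \sum_(i < m) f i.
Proof. by elim: m => [|m IH]; rewrite ?big_ord0 // big_ord_recr /= -IH. Qed.

Lemma eqb_eqE a b : Nat.eqb a b = (a == b).
Proof. by apply/idP/eqP => /PeanoNat.Nat.eqb_eq. Qed.

Lemma ltb_ltnE a b : Nat.ltb a b = (a < b)%N.
Proof.
by apply/idP/idP => [/PeanoNat.Nat.ltb_lt/ssrnat.ltP|/ssrnat.ltP/PeanoNat.Nat.ltb_lt].
Qed.

(** Both sides are expanded along the first row. Indexing [Q] by natural numbers lets the induction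
    reindex minors with [bump], the column skip of [minor]. *)
Lemma pdet_coef m (M : nat -> nat -> Defs.poly) (Q : nat -> nat -> {poly R}) k :
  (forall i j, (i < m)%N -> (j < m)%N -> forall l, M i j l = (Q i j)`_l) ->
  pdet m M k = (\det (\matrix_(i < m, j < m) Q i j))`_k.
Proof.
elim: m M Q k => [|m IH] M Q k MQ.
  by rewrite det_mx00 coefC /= /pconst eqb_eqE.
rewrite (expand_det_row _ ord0) coef_sum.
change (pdet m.+1 M k) with
  (vsum m.+1 (fun j => Rmult (Rpow_def.pow (-1) j) (pmul (M O j) (pdet m (minor M j)) k))).
rewrite vsum_bigE; apply: eq_bigr => j _.
rewrite !mxE /cofactor add0n mulrCA.
have -> : ((-1) ^+ j : {poly R}) = ((-1) ^+ j)%:P by rewrite rmorphXn rmorphN1.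
rewrite coefCM RpowE; congr (_ * _).
rewrite /pmul vsum_bigE coefM; apply: eq_bigr => i _.
rewrite MQ //; congr (_ * _).
rewrite (IH _ (fun a b => Q a.+1 (bump j b))).
  congr (nth _ (polyseq (\det _)) _); apply/matrixP => a b; rewrite !mxE /=.
  by rewrite /bump leq0n.
move=> a b am bm l; rewrite /minor ltb_ltnE /bump.
by case: ltnP => jb; rewrite MQ ?ltnS // ltnW.
Qed.

Lemma charpoly_coef n (A : nat -> nat -> R) k :
  charpoly n A k = (char_poly (\matrix_(i < n, j < n) A i j))`_k.
Proof.
rewrite /charpoly (@pdet_coef _ _
  (fun i j => 'X *+ (i == j) - (A i j)%:P)).
  rewrite /char_poly; congr (nth _ (polyseq (\det _)) _); apply/matrixP => i j.
  by rewrite !mxE -val_eqE.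
move=> i j _ _ l; rewrite eqb_eqE; have [<-|ij] := eqVneq i j.
  by rewrite /padd /pX /pconst !eqb_eqE coefB coefX coefC RplusE RoppE;
    case: l => [|[|l]] /=; rewrite ?subr0 ?sub0r ?addr0 ?add0r.
by rewrite sub0r coefN coefC /pconst eqb_eqE; case: (l == 0%N); rewrite ?oppr0.
Qed.

(** Here [y] is a column; transposition turns it into a row and preserves the characteristic
    polynomial. *)
Lemma charpoly_coef_gt0 n (A : nat -> nat -> R) (y : nat -> R) :
  (forall i j, lt i n -> lt j n -> i <> j -> Rle 0 (A i j)) ->
  (forall i, lt i n -> Rlt 0 (y i)) ->
  (forall i, lt i n -> Rlt (matvec n A y i) 0) ->
  forall k, le k n -> Rgt (charpoly n A k) 0.
Proof.
move=> metA y_gt0 Ay k /ssrnat.leP kn; apply/RltP; rewrite charpoly_coef.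
set B := (\matrix_(i, j) _).
have -> : char_poly B = char_poly B^T.
  rewrite /char_poly -det_tr; congr (\det _); apply/matrixP => i j.
  by rewrite !mxE eq_sym.
apply: (@metzler_char_poly_coef_gt0 R _ _ (\row_(j < n) y j)) => //.
- move=> i j ij; rewrite !mxE; apply/RleP/metA; try exact/ssrnat.ltP.
  by move/ord_inj => ji; rewrite ji eqxx in ij.
- by move=> j; rewrite mxE; apply/RltP/y_gt0/ssrnat.ltP.
- move=> j; apply/RltP; move/ssrnat.ltP: (ltn_ord j) => /Ay.
  rewrite /matvec vsum_bigE mxE; congr (Rlt _ _).
  by apply: eq_bigr => i _; rewrite !mxE mulrC.
Qed.

Lemma charpoly_positive_row n (A : nat -> nat -> R) :
  (forall i j, lt i n -> lt j n -> i <> j -> Rle 0 (A i j)) ->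
  (forall k, le k n -> Rgt (charpoly n A k) 0) ->
  exists w : nat -> R,
    (forall i, lt i n -> Rlt 0 (w i)) /\
    (forall j, lt j n -> Rlt (vsum n (fun i => Rmult (w i) (A i j))) 0).
Proof.
move=> metA chi_gt0; pose B : 'M[R]_n := \matrix_(i, j) A i j.
have [|a a_ge0|w [w_gt0 wB]] := @metzler_positive_row R n B.
- move=> i j ij; rewrite !mxE; apply/RleP/metA; try exact/ssrnat.ltP.
  by move/ord_inj => ji; rewrite ji eqxx in ij.
- have coef_gt0 k : (k <= n)%N -> 0 < (char_poly B)`_k.
    by move=> /ssrnat.leP kn; apply/RltP; rewrite -charpoly_coef; apply: chi_gt0.
  (* At [a >= 0] the constant term is positive and all other terms are nonnegative. *)
  rewrite horner_coef size_char_poly big_ord_recl expr0 mulr1 ltr_pwDl ?coef_gt0 //.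
  apply: sumr_ge0 => i _; apply: mulr_ge0; last exact: exprn_ge0.
  by apply/ltW/coef_gt0; rewrite -ltnS ltn_ord.
- pose w' i := if insub i is Some j then w 0 (j : 'I_n) else 0.
  have w'E (i : 'I_n) : w' i = w 0 i by rewrite /w' valK.
  exists w'; split=> i /ssrnat.ltP i_n.
    by rewrite -[i]/(val (Ordinal i_n)) w'E; apply/RltP.
  apply/RltP; have := wB (Ordinal i_n); rewrite mxE vsum_bigE.
  by under eq_bigr do rewrite mxE -w'E.
Qed.

End MetzlerMatrices.

(** * Positivity and stability *)

Lemma vec_bounds n (f : nat -> R) :
  (forall i, (i < n)%nat -> 0 < f i) ->
  exists m M, 0 < m <= M /\ forall i, (i < n)%nat -> m <= f i <= M.
Proof.
  induction n as [|n IH]; intros Hf.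
  - exists 1, 1; split; [lra|intros; lia].
  - destruct IH as (m & M & Hm & HmM); [auto|].
    pose proof (Hf n (Nat.lt_succ_diag_r n)).
    exists (Rmin m (f n)), (Rmax M (f n)).
    pose proof (Rmin_l m (f n)); pose proof (Rmin_r m (f n)).
    pose proof (Rmax_l M (f n)); pose proof (Rmax_r M (f n)).
    split.
    + split; [apply Rmin_glb_lt; lra|lra].
    + intros i Hi; destruct (Nat.eq_dec i n) as [->|N]; [lra|].
      specialize (HmM i ltac:(lia)); lra.
Qed.

Lemma matvec_basis n A i j :
  (j < n)%nat -> matvec n A (fun k => if Nat.eqb k j then 1 else 0) i = A i j.
Proof.
  unfold matvec; induction n as [|n IH]; intros Hj; [lia|]; cbn.
  destruct (Nat.eqb_spec n j) as [->|N].
  - rewrite (vsum_ext j _ (fun k => 0 * A i k)).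
    + rewrite vsum_scal; ring.
    + intros k Hk; destruct (Nat.eqb_spec k j); [lia|ring].
  - rewrite IH by lia; ring.
Qed.

Lemma matvec_vec_eq n A x y i : vec_eq n x y -> matvec n A x i = matvec n A y i.
Proof. intros H; apply vsum_ext; intros j Hj; rewrite H; auto. Qed.

(** The solution started at the [j]-th basis vector has [i]-th component 0 at time [t], nonnegative
    afterwards, and delta derivative [A i j] at [t]. The sign is read off the jump if [t] is
    right-scattered, and off difference quotients at nearby later times otherwise. *)
Lemma positive_system_offdiag T n A :
  is_time_scale T -> sup_infinite T -> positive_system T n A ->
  forall i j, (i < n)%nat -> (j < n)%nat -> i <> j -> 0 <= A i j.
Proof.
  intros [[t Tt] HT] Hinf Hpos i j Hi Hj Hij.
  set (e := fun k => if Nat.eqb k j then 1 else 0).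
  set (x := ivp_solution T t n A e).
  assert (Hx : is_forward_solution T n A t x) by (apply ivp_solution_correct; auto).
  assert (Hx0 : vec_eq n (x t) e) by (intros k _; apply ivp_solution_init; auto).
  assert (Hge : forall s, T s -> t <= s -> nonneg_vec n (x s)).
  { intros s Ts Hs; apply (Hpos t e x); auto.
    intros k _; unfold e; destruct (Nat.eqb k j); lra. }
  assert (Hxi : x t i = 0).
  { rewrite Hx0 by auto; unfold e; destruct (Nat.eqb_spec i j); [lia|auto]. }
  assert (HD := Hx t Tt (Rle_refl t) i Hi).
  rewrite (matvec_vec_eq n A _ e i Hx0) in HD; unfold e in HD.
  rewrite (matvec_basis n A i j Hj) in HD.
  destruct (sigma_exists T t Hinf) as [sg Hsg].
  destruct (sigma_ge T t sg Hsg) as [Hlt|Heq].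
  - assert (HJ := delta_deriv_jump T t _ t _ sg (conj Tt (Rle_refl t)) Hsg HD).
    cbn beta in HJ; rewrite Hxi in HJ.
    assert (0 <= x sg i).
    { apply Hge; auto; [eapply sigma_in; eauto|lra]. }
    apply Rmult_le_reg_r with (sg - t); lra.
  - rewrite <- Heq in Hsg; clear Heq.
    apply le_epsilon; intros eps He.
    destruct (HD t Hsg eps He) as (d & Hd & Hb).
    destruct (sigma_approx T t t d Hsg Hd) as (s & Ts & Hts & Hs).
    assert (B : Rabs (x t i - x s i - A i j * (t - s)) <= eps * Rabs (t - s)).
    { apply Hb; [split; [auto|lra]|apply Rabs_def1; lra]. }
    rewrite Hxi, (Rabs_left (t - s)) in B by lra.
    apply Rabs_le_between in B.
    assert (0 <= x s i) by (apply Hge; auto; lra).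
    apply Rmult_le_reg_r with (s - t); lra.
Qed.

(* Starting from a small positive multiple [e] of the all-one vector, the
   integral [y] of the solution [x] satisfies [A y = x - e], which is negative
   once [x] has decayed. *)
Lemma stable_negative_image T n A :
  is_time_scale T -> sup_infinite T -> positive_system T n A ->
  pos_unif_exp_stable T n A ->
  exists y, (forall i, (i < n)%nat -> 0 < y i) /\
            (forall i, (i < n)%nat -> matvec n A y i < 0).
Proof.
  intros HTs Hinf Hpos (K & a & V & HK & Ha & [HV0 HV] & Hst).
  pose proof (positive_system_offdiag T n A HTs Hinf Hpos) as Hmet.
  destruct HTs as [[t0 T0] HT].
  destruct (HV _ HV0) as (r & Hr & HrV).
  set (e := r / 2).
  assert (He : 0 < e < r) by (unfold e; lra).
  set (x0 := fun _ : nat => e).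
  assert (Hx0 : V x0).
  { apply HrV; intros i _; unfold x0; rewrite Rabs_right; lra. }
  set (x := ivp_solution T t0 n A x0).
  set (y := ivp_integral T t0 n A x0).
  assert (Hx : is_forward_solution T n A t0 x) by (apply ivp_solution_correct; auto).
  assert (Hxi : vec_eq n (x t0) x0) by (intros k _; apply ivp_solution_init; auto).
  assert (Hx0p : nonneg_vec n x0) by (intros k _; unfold x0; lra).
  assert (Hnorm : vnorm n x0 = INR n * e).
  { clear - He; unfold vnorm, x0; induction n as [|n IH]; [cbn; ring|].
    cbn [vsum]; rewrite IH, S_INR, Rabs_right; [ring|lra]. }
  (* So late that [exp (a * (t - t0))] exceeds [K * INR n]; since [x0] has norm [INR n * e], all
     components of [x t] are then below [e]. *)
  destruct (Hinf (t0 + (K * INR n) / a)) as (t & Tt & Ht).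
  pose proof (pos_INR n).
  assert (HKn : 0 <= K * INR n) by (apply Rmult_le_pos; lra).
  assert (Htt : K * INR n < a * (t - t0)).
  { assert (K * INR n / a < t - t0) by lra.
    apply Rmult_lt_compat_l with (r := a) in H0; [|lra].
    replace (a * (K * INR n / a)) with (K * INR n) in H0 by (field; lra). lra. }
  assert (Ht0 : t0 <= t) by nra.
  assert (Hdecay : forall i, (i < n)%nat -> x t i < e).
  { intros i Hi.
    assert (B := Hst t0 t x0 x T0 Tt Ht0 Hx0p Hx0 Hx Hxi).
    assert (x t i <= vnorm n (x t)).
    { eapply Rle_trans; [apply Rle_abs|].
      apply (vsum_ge_term n (fun i => Rabs (x t i))); auto; intros; apply Rabs_pos. }
    rewrite Hnorm in B.
    assert (E : exp (- a * (t - t0)) * exp (a * (t - t0)) = 1).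
    { rewrite <- exp_plus, <- exp_0; f_equal; ring. }
    pose proof (exp_ineq1_le (a * (t - t0))).
    pose proof (exp_pos (- a * (t - t0))).
    set (u := exp (- a * (t - t0))) in *; set (v := exp (a * (t - t0))) in *.
    assert (u * (K * INR n) < u * v) by (apply Rmult_lt_compat_l; lra).
    assert (u * (K * INR n) * e < 1 * e) by (apply Rmult_lt_compat_r; lra).
    lra. }
  assert (Hy0 : forall i, (i < n)%nat -> 0 <= y t i).
  { intros i Hi; rewrite <- (ivp_integral_init T t0 T0 n A x0 i).
    apply (delta_deriv_nonneg_nondecreasing T t0 (fun s => y s i) (fun s => x s i));
      auto.
    - intros s Ts Hs; apply ivp_integral_deriv; auto.
    - intros s Ts Hs; apply (Hpos t0 x0 x); auto. }
  assert (HAy : forall i, (i < n)%nat -> matvec n A (y t) i < 0).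
  { intros i Hi; specialize (Hdecay i Hi).
    unfold x in Hdecay; rewrite (ivp_solution_integral T t0 T0 n A x0 i t Hi Tt Ht0)
      in Hdecay.
    fold y in Hdecay; change (x0 i) with e in Hdecay; lra. }
  exists (y t); split; auto.
  (* If [y_i] were 0, only nonnegative off-diagonal terms would remain in [(A y)_i], which is
     negative. *)
  intros i Hi; destruct (Hy0 i Hi) as [|E]; [assumption|exfalso].
  specialize (HAy i Hi).
  assert (0 <= matvec n A (y t) i); [|lra].
  apply vsum_nonneg; intros j Hj.
  destruct (Nat.eq_dec i j) as [<-|N]; [rewrite <- E; lra|].
  apply Rmult_le_pos; auto.
Qed.

(** On nonnegative solutions [f = w x] lies between [m] and [M] times the norm, and its delta
    derivative [w A x] is at most [- p] times the norm, hence at most [- (p / M) f]. *)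
Lemma negative_row_stable T n A w :
  is_time_scale T -> sup_infinite T -> positive_system T n A ->
  (forall i, (i < n)%nat -> 0 < w i) ->
  (forall j, (j < n)%nat -> vsum n (fun i => w i * A i j) < 0) ->
  pos_unif_exp_stable T n A.
Proof.
  intros HTs Hinf Hpos Hw HwA; destruct HTs as [_ HT].
  destruct (vec_bounds n w Hw) as (m & M & Hm & HmM).
  destruct (vec_bounds n (fun j => - vsum n (fun i => w i * A i j))) as
    (p & P & Hp & HpP).
  { intros j Hj; specialize (HwA j Hj); lra. }
  set (a := p / M).
  assert (Ha : 0 < a) by (apply Rdiv_lt_0_compat; lra).
  assert (HMm : 1 <= M / m) by (apply Rle_div_r; lra).
  (* [M / m] is the cost of passing from the norm to [f] and back; [a / 2] is a rate strictly below
     [a], as the decay lemma demands. *)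
  exists (M / m), (a / 2), (fun _ => True).
  split; [lra|split; [lra|split]].
  { split; auto; intros; exists 1; split; auto; lra. }
  intros t0 t x0 x T0 Tt Ht Hx0 _ Hx Hxi.
  assert (Hge : forall s, T s -> t0 <= s -> nonneg_vec n (x s))
    by (intros s Ts Hs; apply (Hpos t0 x0 x); auto).
  set (f := fun s => vsum n (fun i => w i * x s i)).
  set (f' := fun s => vsum n (fun i => w i * matvec n A (x s) i)).
  assert (Hnorm : forall s, T s -> t0 <= s ->
            m * vnorm n (x s) <= f s <= M * vnorm n (x s)).
  { intros s Ts Hs; unfold f, vnorm; rewrite <- !vsum_scal.
    split; apply vsum_le; intros i Hi; specialize (Hge s Ts Hs i Hi);
      rewrite Rabs_right by lra; apply Rmult_le_compat_r; auto; apply HmM; auto. }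
  assert (D : f t <= exp (- (a / 2) * (t - t0)) * f t0).
  { apply (delta_deriv_exp_decay T t0 f f' a); auto; [lra| | |].
    - intros s Ts Hs.
      apply (delta_deriv_vsum T t0 n (fun i s => w i * x s i)); intros i Hi.
      apply (delta_deriv_scal T t0 (w i) (fun s => x s i)); apply Hx; auto.
    - intros s Ts Hs; unfold f', f, matvec.
      apply Rle_trans with (- p * vnorm n (x s)).
      + rewrite (vsum_ext n _ (fun i => vsum n (fun j => w i * A i j * x s j))).
        2: { intros i Hi; rewrite <- vsum_scal; apply vsum_ext; intros; ring. }
        rewrite vsum_exchange; unfold vnorm; rewrite <- vsum_scal.
        apply vsum_le; intros j Hj; specialize (Hge s Ts Hs j Hj).
        rewrite (vsum_ext n _ (fun i => x s j * (w i * A i j))) by (intros; ring).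
        rewrite vsum_scal, Rabs_right, Rmult_comm by lra.
        apply Rmult_le_compat_r; auto; specialize (HpP j Hj); cbn beta in HpP; lra.
      + destruct (Hnorm s Ts Hs) as [_ U].
        apply (Rmult_le_compat_l a) in U; [|lra].
        replace (a * (M * vnorm n (x s))) with (p * vnorm n (x s)) in U
          by (unfold a; field; lra).
        fold (f s); lra.
    - intros s Ts Hs; apply vsum_nonneg; intros i Hi.
      apply Rmult_le_pos; [left; auto|apply Hge; auto]. }
  destruct (Hnorm t Tt Ht) as [L _].
  destruct (Hnorm t0 T0 (Rle_refl _)) as [_ U].
  assert (Hv : vnorm n (x t0) = vnorm n x0).
  { apply vsum_ext; intros i Hi; rewrite Hxi; auto. }
  rewrite Hv in U.
  pose proof (exp_pos (- (a / 2) * (t - t0))) as Hexp.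
  apply Rmult_le_reg_l with m; [lra|].
  apply Rle_trans with (exp (- (a / 2) * (t - t0)) * (M * vnorm n x0)).
  - apply Rle_trans with (f t); auto.
    apply Rle_trans with (exp (- (a / 2) * (t - t0)) * f t0); auto.
    apply Rmult_le_compat_l; lra.
  - apply Req_le; field; lra.
Qed.

Theorem theorem4 (T : R -> Prop) (n : nat) (A : nat -> nat -> R) :
  is_time_scale T ->
  sup_infinite T ->
  bounded_graininess T ->
  positive_system T n A ->
  (pos_unif_exp_stable T n A <->
   (forall k, (k <= n)%nat -> charpoly n A k > 0)).
Proof.
  intros HT Hinf _ Hpos.
  pose proof (positive_system_offdiag T n A HT Hinf Hpos) as Hmet.
  split.
  - intros Hst.
    destruct (stable_negative_image T n A HT Hinf Hpos Hst) as (y & Hy & HAy).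
    exact (@MetzlerMatrices.charpoly_coef_gt0 n A y Hmet Hy HAy).
  - intros Hchi.
    destruct (@MetzlerMatrices.charpoly_positive_row n A Hmet Hchi) as (w & Hw & HwA).
    exact (negative_row_stable T n A w HT Hinf Hpos Hw HwA).
Qed.
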